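(* Assume GCH. Let $\kappa$ be either a limit cardinal or $\kappa=\omega$, and fix a natural number $k\ge 1$. Then for every $n<\omega$ and every natural number $t$ with $t>k$: \[ \chi_{\rm CF}(\kappa^{+n},t,k+1)=\begin{cases}\kappa^{+(n+1-i)} & \text{if } i\cdot k<t\le (i+1)\cdot k \text{ for some } i\in\{1,\dots,n\},\\ \kappa & \text{if } (n+1)\cdot k<t.\end{cases} \]
   Context: For a family $\mathcal A$ of sets and a cardinal $\rho$, a function $f:\bigcup\mathcal A\to\rho$ is a conflict free coloring of $\mathcal A$ if for every $A\in\mathcal A$ there is $\zeta<\rho$ with $|A\cap f^{-1}\{\zeta\}|=1$; $\chi_{\rm CF}(\mathcal A)$ is the least $\rho$ for which such a coloring exists. A family $\mathcal A$ is $\mu$-almost disjoint if $|A\cap A'|<\mu$ for distinct $A,A'\in\mathcal A$. A $(\lambda,\kappa,\mu)$-system is a $\mu$-almost disjoint family $\mathcal A$ with $|\mathcal A|=\lambda$ and $|A|=\kappa$ for all $A\in\mathcal A$ (members are assumed to have at least two elements). For $\lambda\ge\kappa\ge\mu$ with $\lambda$ infinite, $\chi_{\rm CF}(\lambda,\kappa,\mu)=\sup\{\chi_{\rm CF}(\mathcal A):\mathcal A$ is a $(\lambda,\kappa,\mu)$-system$\}$. $\kappa^{+n}$ denotes the $n$-th successor cardinal of $\kappa$. *)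

(* Defs.v *)
From Stdlib Require Import Arith.

Definition le_card (A B : Type) : Prop := exists f : A -> B, forall x y, f x = f y -> x = y.
Definition eq_card (A B : Type) : Prop :=
  exists (f : A -> B) (g : B -> A), (forall x, g (f x) = x) /\ (forall y, f (g y) = y).
Definition lt_card (A B : Type) : Prop := le_card A B /\ ~ le_card B A.

Definition infinite_card (A : Type) : Prop := le_card nat A.

Definition fin (t : nat) : Type := { m : nat | m < t }.

Definition GCH : Prop :=
  forall A : Type, infinite_card A ->
  forall B : Type, le_card A B -> le_card B (A -> Prop) ->
  eq_card A B \/ eq_card B (A -> Prop).

Definition is_succ_card (A B : Type) : Prop :=
  lt_card A B /\ forall C : Type, lt_card A C -> le_card B C.

Fixpoint succ_n (n : nat) (A B : Type) : Prop :=
  match n with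
  | 0 => eq_card A B
  | S m => exists C : Type, succ_n m A C /\ is_succ_card C B
  end.

(* |K| is a limit cardinal: infinite and not a successor cardinal,
   i.e. between any smaller cardinal and K there is another one. *)
Definition limit_card (K : Type) : Prop :=
  infinite_card K /\
  forall A : Type, lt_card A K -> exists B : Type, lt_card A B /\ lt_card B K.

Definition system (L : Type) (t mu : nat) (X I : Type) (A : I -> X -> Prop) : Prop :=
  eq_card I L /\
  (forall i j, A i = A j -> i = j) /\
  (forall x : X, exists i, A i x) /\
  (forall i, eq_card {x : X | A i x} (fin t)) /\
  (forall i j, i <> j -> lt_card {x : X | A i x /\ A j x} (fin mu)).

Definition cf_coloring (X I P : Type) (A : I -> X -> Prop) (f : X -> P) : Prop :=
  forall i, exists c : P, eq_card {x : X | A i x /\ f x = c} unit.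

Definition cf_colorable (X I P : Type) (A : I -> X -> Prop) : Prop :=
  exists f : X -> P, cf_coloring X I P A f.

(* chi_CF(lambda, t, mu) = |M|, where lambda = |L|: the supremum over all
   (lambda,t,mu)-systems of chi_CF equals |M|, i.e. every system has
   chi_CF <= |M|, and for every |N| < |M| some system has chi_CF > |N|. *)
Definition chiCF_eq (L : Type) (t mu : nat) (M : Type) : Prop :=
  (forall (X I : Type) (A : I -> X -> Prop), system L t mu X I A -> cf_colorable X I M A) /\
  (forall N : Type, lt_card N M ->
     exists (X I : Type) (A : I -> X -> Prop), system L t mu X I A /\ ~ cf_colorable X I N A).

(* Main.v *)
(* Upper bounds (no GCH needed). Well-order the points in the type of the
   successor cardinal and close initial segments under "a set with k+1 points in
   the closure is contained in it". This splits the points into layers of smaller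
   cardinality such that each set has at most k points below its top layer.
   Colouring the layers recursively, each step costs k points per set, provided the
   unique colour is allowed to avoid a finite list given in advance (the colours
   of the lower points).

   Lower bounds. For infinitely many colours P, one builds by induction on i, on
   P^{+i}, a family of sets of size ik+s that defeats every colouring: take P^{+(i+1)}
   copies of the previous family and add to each set of the a-th copy k points
   from earlier copies, guessed in advance; under GCH there are only P^{+(i+1)}
   guesses. For K limit and N < K infinite, N^{+i} < K. For finitely many
   colours, a finite linear hypergraph without proper colouring is used. *)
Require Import Defs.
From Stdlib Require Import Arith Lia List Classical ClassicalEpsilon.
From Stdlib Require Import FunctionalExtensionality PropExtensionality ProofIrrelevance.
From Stdlib Require Import Wellfounded Relation_Operators FinFun.
From mathcomp Require ssreflect ssrfun ssrbool eqtype boolp wochoice.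
Import ListNotations.

(** The thresholds for [t] come from two counts that meet. A palette [P] handles more than [k]
    points per set as long as there are at most [P] points altogether, hence more than [(m + 1) * k]
    when there are [P^{+m}]. A defeating set has at most [k] points at the start and gains [k] in
    each of [i] steps, which reaches every [t <= (i + 1) * k]. From the palette [K^{+(n+1-i)}] it
    takes [i - 1] successors to reach [K^{+n}]; from the largest smaller palette, [K^{+(n-i)}], it
    takes [i]. In the lower bound exactly [k] points can be added: sets of different copies may meet
    in all added points of the later one. The guess has to be made from the colouring alone, because
    the copy that realizes it, and the old set defeated there, are found only afterwards. So one
    guess serves all old sets at once, and each guess is repeated in as many copies as there are. *)

Definition strict_well_order {T : Type} (R : T -> T -> Prop) : Prop :=
  well_founded R /\ (forall x y z, R x y -> R y z -> R x z) /\
  (forall x y, R x y \/ x = y \/ R y x).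

(** * Well-orderings and recursive choice along them *)

Module WellOrdering.
Import ssreflect ssrfun ssrbool eqtype boolp wochoice.

(** Every nonempty predicate has a unique [r]-least element: two-point predicates make [r] total and
    antisymmetric, three-point ones give transitivity. The strict order is the negation of the
    converse of [r]. *)
Lemma well_ordering (T : Type) : exists R : T -> T -> Prop, strict_well_order R.
Proof.
have [r wo] := well_ordering_principle (classicType T).
have least (A : T -> Prop) : (exists x, A x) ->
    exists z, (A z /\ forall x, A x -> r z x) /\
      forall w, A w -> (forall x, A x -> r w x) -> z = w.
  move=> [x Ax].
  have [|z [[Az lb] uz]] := wo (fun x => `[< A x >]).
    by exists x; apply/asboolP.
  exists z; split; first split.
  - exact/asboolP.
  - by move=> y Ay; apply: lb; apply/asboolP.
  - move=> w Aw wl; apply: uz; split; first exact/asboolP.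
    by move=> y /asboolP; apply: wl.
have rxx x : r x x.
  by have [|z [[-> +] _]] := least (eq x); [exists x | apply].
have tot x y : r x y \/ r y x.
  have [|z [[zxy zl] _]] := least (fun z => z = x \/ z = y); first by exists x; left.
  by case: zxy zl => -> zl; [left | right]; apply: zl; [right | left].
have anti x y : r x y -> r y x -> x = y.
  move=> xy yx; have [|z [_ uz]] := least (fun z => z = x \/ z = y).
    by exists x; left.
  have zx : z = x by apply: uz; [left | move=> w [] ->].
  have zy : z = y by apply: uz; [right | move=> w [] ->].
  by rewrite -zx.
exists (fun x y => ~ r y x); split; [|split].
- move=> x; apply: NNPP => nx.
  have [|z [[nz zl] _]] := least (fun x => ~ Acc (fun x y => ~ r y x) x).
    by exists x.
  by apply: nz; split=> y nzy; apply: NNPP => /zl.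
- move=> x y z nyx nzy zx.
  have [|w [[wxyz wl] _]] := least (fun w => w = x \/ w = y \/ w = z).
    by exists x; left.
  case: wxyz wl => [->|[->|->]] wl.
  + apply: nzy; rewrite (anti z x) //; first by apply: wl; intuition.
    by apply: wl; intuition.
  + by apply: nyx; apply: wl; intuition.
  + by apply: nzy; apply: wl; intuition.
- move=> x y; case: (EM (r y x)) => yx; last by left.
  case: (EM (r x y)) => xy; last by right; right.
  by right; left; apply: anti.
Qed.

End WellOrdering.
Import WellOrdering.

Lemma functional_choice {A B : Type} (R : A -> B -> Prop) :
  (forall x, exists y, R x y) -> exists f, forall x, R x (f x).
Proof.
  intros H.
  exists (fun x => proj1_sig (constructive_indefinite_description _ (H x))).
  intros x; apply proj2_sig.
Qed.

Lemma subtype_eq {X : Type} (P : X -> Prop) (x y : {x | P x}) :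
  proj1_sig x = proj1_sig y -> x = y.
Proof. apply eq_sig_hprop; intros; apply proof_irrelevance. Qed.

Lemma well_order_irrefl {T : Type} (R : T -> T -> Prop) (x : T) :
  well_founded R -> ~ R x x.
Proof. intros wf; induction (wf x) as [x _ IH]; intros H; exact (IH x H H). Qed.

Lemma well_order_least {T : Type} (R : T -> T -> Prop) (P : T -> Prop) :
  strict_well_order R -> (exists x, P x) ->
  exists x, P x /\ forall y, P y -> x = y \/ R x y.
Proof.
  intros (wf & _ & tot) [x Px].
  apply NNPP; intros N; revert x Px.
  refine (well_founded_ind wf _ _); intros x IH Px.
  apply N; exists x; split; [exact Px|]; intros y Py.
  destruct (tot x y) as [h|[h|h]]; auto.
  exfalso; exact (IH y h Py).
Qed.

Lemma well_order_pullback {A B : Type} (R : B -> B -> Prop) (f : A -> B) :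
  strict_well_order R -> (forall x y, f x = f y -> x = y) ->
  strict_well_order (fun x y => R (f x) (f y)).
Proof.
  intros (wf & tr & tot) inj; split; [|split].
  - apply wf_inverse_image; exact wf.
  - intros x y z; apply tr.
  - intros x y; destruct (tot (f x) (f y)) as [h|[h|h]]; auto.
Qed.

(** Recursion in which the value at [b] only has to satisfy a relation to the earlier values. [Phi]
    takes a total function, so values not yet defined are filled with [t0]; by the locality
    hypothesis the filling has no influence. *)
Lemma wf_recursive_choice {B T : Type} (R : B -> B -> Prop)
    (Phi : B -> (B -> T) -> T -> Prop) :
  well_founded R -> inhabited T ->
  (forall b g, exists t, Phi b g t) ->
  (forall b g g' t, (forall b', R b' b -> g b' = g' b') -> Phi b g t -> Phi b g' t) ->
  exists G : B -> T, forall b, Phi b G (G b).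
Proof.
  intros wf [t0] ex loc.
  pose (extend := fun b (rec : forall b', R b' b -> T) b' =>
    match excluded_middle_informative (R b' b) with
    | left h => rec b' h | right _ => t0 end).
  pose (F := fun b (rec : forall b', R b' b -> T) =>
    epsilon (inhabits t0) (Phi b (extend b rec))).
  exists (Fix wf (fun _ => T) F); intros b.
  assert (E : Fix wf (fun _ => T) F b
    = F b (fun b' _ => Fix wf (fun _ => T) F b')).
  { refine (Fix_eq wf (fun _ => T) F _ b); intros x f g fg.
    assert (f = g) as ->; [|reflexivity].
    apply functional_extensionality_dep; intros y.
    apply functional_extensionality_dep; intros h; apply fg. }
  rewrite E; apply loc with (2 := epsilon_spec _ _ (ex b (extend b _))).
  intros b' h; unfold extend.
  destruct (excluded_middle_informative (R b' b)); [reflexivity|contradiction].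
Qed.

(** * Comparison of cardinals *)

Lemma le_card_refl (A : Type) : le_card A A.
Proof. exists (fun x => x); auto. Qed.

Lemma le_card_trans (A B C : Type) : le_card A B -> le_card B C -> le_card A C.
Proof. intros [f hf] [g hg]; exists (fun x => g (f x)); auto. Qed.

Lemma le_card_of_rel {A B : Type} (R : A -> B -> Prop) :
  (forall x, exists y, R x y) -> (forall x x' y, R x y -> R x' y -> x = x') ->
  le_card A B.
Proof.
  intros ex inj; destruct (functional_choice R ex) as [f hf].
  exists f; intros x y E; apply (inj x y (f x)); [apply hf|rewrite E; apply hf].
Qed.

Lemma eq_card_of_bijection {A B : Type} (f : A -> B) :
  (forall x y, f x = f y -> x = y) -> (forall b, exists a, f a = b) -> eq_card A B.
Proof.
  intros inj sur; destruct (functional_choice _ sur) as [g hg].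
  exists f, g; split; auto.
Qed.

Lemma eq_card_le (A B : Type) : eq_card A B -> le_card A B.
Proof.
  intros (f & g & gf & fg); exists f; intros x y E.
  rewrite <- (gf x), <- (gf y), E; reflexivity.
Qed.

Lemma eq_card_sym (A B : Type) : eq_card A B -> eq_card B A.
Proof. intros (f & g & gf & fg); exists g, f; auto. Qed.

Lemma Cantor_Bernstein (A B : Type) : le_card A B -> le_card B A -> eq_card A B.
Proof.
  intros [f finj] [g ginj].
  (* The points reached by iterating [g] after [f] from a point outside the image of [g]: on them
     [f] is used, on all others the inverse of [g]. *)
  pose (P := fun a => exists n a0, (forall b, g b <> a0) /\
    a = Nat.iter n (fun x => g (f x)) a0).
  assert (H : forall a, exists b, (P a -> b = f a) /\ (~ P a -> g b = a)).
  { intros a; destruct (classic (P a)) as [h|h].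
    - exists (f a); tauto.
    - destruct (classic (exists b, g b = a)) as [[b hb]|nb].
      + exists b; tauto.
      + exfalso; apply h; exists 0, a; split; [intros b hb; eauto|reflexivity]. }
  destruct (functional_choice _ H) as [h hh].
  assert (step : forall a, P a -> P (g (f a))).
  { intros a (n & a0 & h0 & E); exists (S n), a0; split; [exact h0|].
    rewrite E; reflexivity. }
  apply eq_card_of_bijection with h.
  - intros x y E; destruct (hh x) as [x1 x2], (hh y) as [y1 y2].
    destruct (classic (P x)) as [px|px], (classic (P y)) as [py|py].
    + apply finj; rewrite <- x1, <- y1; auto.
    + exfalso; apply py; rewrite <- y2, <- E, x1 by auto; auto.
    + exfalso; apply px; rewrite <- x2, E, y1 by auto; auto.
    + rewrite <- x2, <- y2, E; auto.
  - intros b; destruct (hh (g b)) as [h1 h2].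
    destruct (classic (P (g b))) as [p|p].
    + destruct p as (n & a0 & h0 & E); destruct n as [|n].
      * exfalso; exact (h0 b E).
      * simpl in E; apply ginj in E; exists (Nat.iter n (fun x => g (f x)) a0).
        rewrite E; apply hh; exists n, a0; auto.
    + exists (g b); apply ginj; auto.
Qed.

Lemma le_card_of_segments {A B : Type} (R : B -> B -> Prop) :
  well_founded R -> (forall x y, R x y \/ x = y \/ R y x) ->
  (forall p, ~ le_card A {q | R q p}) -> le_card B A.
Proof.
  intros wf tot seg.
  destruct (classic (inhabited B)) as [[b0]|nB].
  2: { exists (fun b => False_rect _ (nB (inhabits b))); intros x.
       exfalso; exact (nB (inhabits x)). }
  assert (iA : inhabited A).
  { apply NNPP; intros nA; apply (seg b0).
    exists (fun a => False_rect _ (nA (inhabits a))); intros x.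
    exfalso; exact (nA (inhabits x)). }
  destruct (wf_recursive_choice R
    (fun b (g : B -> A) t => forall b', R b' b -> g b' <> t) wf iA) as [G hG].
  - intros b g; apply NNPP; intros N; apply (seg b).
    apply le_card_of_rel with (fun a q => g (proj1_sig q) = a).
    + intros a; apply NNPP; intros Na; apply N; exists a; intros b' h E.
      apply Na; exists (exist _ b' h); exact E.
    + intros; congruence.
  - intros b g g' t E h b' hb'; rewrite <- E by exact hb'; auto.
  - exists G; intros x y E; destruct (tot x y) as [h|[h|h]]; auto.
    + exfalso; exact (hG y x h E).
    + exfalso; exact (hG x y h (eq_sym E)).
Qed.

Lemma le_card_total (A B : Type) : le_card A B \/ le_card B A.
Proof.
  destruct (well_ordering B) as [R wo].
  destruct (classic (exists p, le_card A {q | R q p})) as [[p h]|N].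
  - left; apply le_card_trans with (1 := h); exists (@proj1_sig _ _).
    apply subtype_eq.
  - right; destruct wo as (wf & _ & tot); apply (le_card_of_segments R wf tot); eauto.
Qed.

Lemma not_le_card (A B : Type) : ~ le_card A B -> le_card B A.
Proof. destruct (le_card_total A B); tauto. Qed.

(** Cut a well-order at the first point whose segment receives [A], and pull it back along that
    embedding: a segment as large as [A] would contradict the choice of the cut. *)
Lemma initial_well_ordering (A : Type) :
  exists R : A -> A -> Prop, strict_well_order R /\
    forall a, ~ le_card A {b | R b a}.
Proof.
  destruct (well_ordering A) as [R wo].
  destruct (classic (exists a, le_card A {b | R b a})) as [h|N].
  2: exists R; split; [exact wo|]; eauto.
  destruct (well_order_least R _ wo h) as (x & [i hi] & least).
  set (f := fun a => proj1_sig (i a)).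
  assert (finj : forall a b, f a = f b -> a = b).
  { intros a b E; apply hi, subtype_eq, E. }
  exists (fun a b => R (f a) (f b)); split.
  - apply well_order_pullback; assumption.
  - intros a le; assert (Rax : R (f a) x) by apply (proj2_sig (i a)).
    destruct wo as (wf & tr & _).
    destruct (least (f a)) as [E|E].
    + apply le_card_trans with (1 := le).
      exists (fun b => exist (fun c => R c (f a)) (f (proj1_sig b)) (proj2_sig b)).
      intros b c E; apply subtype_eq, finj; exact (f_equal (@proj1_sig _ _) E).
    + rewrite <- E in Rax; exact (well_order_irrefl R x wf Rax).
    + exact (well_order_irrefl R x wf (tr _ _ _ E Rax)).
Qed.

Lemma le_card_Finite (A B : Type) : le_card A B -> Finite B -> Finite A.
Proof.
  intros [f hf] [l hl].
  assert (H : forall l : list B, exists l' : list A, forall a, In (f a) l -> In a l').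
  { clear l hl; induction l as [|b l [l' IH]]; [exists []; auto|].
    destruct (classic (exists a, f a = b)) as [[a E]|N].
    - exists (a :: l'); intros a' [E'|h]; [left; apply hf; congruence|right; auto].
    - exists l'; intros a' [E'|h]; [exfalso; eauto|auto]. }
  destruct (H l) as [l' hl']; exists l'; intros a; apply hl', hl.
Qed.

Lemma Finite_prod (A B : Type) : Finite A -> Finite B -> Finite (A * B).
Proof.
  intros [l hl] [m hm]; exists (list_prod l m); intros [a b].
  apply in_prod; auto.
Qed.

Lemma Finite_sum (A B : Type) : Finite A -> Finite B -> Finite (A + B).
Proof.
  intros [l hl] [m hm]; exists (map inl l ++ map inr m); intros [a|b];
  apply in_or_app; [left|right]; apply in_map; auto.
Qed.

Lemma not_Finite_infinite (A : Type) : ~ Finite A -> infinite_card A.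
Proof.
  intros N.
  assert (H : forall l : list A, exists x, ~ In x l).
  { intros l; apply NNPP; intros Nl; apply N; exists l; intros x.
    apply NNPP; eauto. }
  destruct (functional_choice _ H) as [f hf].
  set (L := fun n => Nat.iter n (fun l => f l :: l) []).
  assert (sub : forall m n, m < n -> In (f (L m)) (L n)).
  { intros m n h; induction h as [|n h IH]; [left; reflexivity|right; exact IH]. }
  exists (fun n => f (L n)); intros m n E.
  destruct (Nat.lt_trichotomy m n) as [h|[h|h]]; auto; exfalso.
  - apply (hf (L n)); rewrite <- E; auto.
  - apply (hf (L m)); rewrite E; auto.
Qed.

Lemma infinite_not_Finite (A : Type) : infinite_card A -> ~ Finite A.
Proof.
  intros [f hf] [l hl].
  assert (h : length (map f (seq 0 (S (length l)))) <= length l).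
  { apply NoDup_incl_length; [|intros x _; apply hl].
    apply Injective_map_NoDup; [exact hf|apply seq_NoDup]. }
  rewrite length_map, length_seq in h; lia.
Qed.

(** * Products, sums and lists of infinite cardinals *)

Lemma le_card_prod (A B C D : Type) :
  le_card A C -> le_card B D -> le_card (A * B) (C * D).
Proof.
  intros [f hf] [g hg]; exists (fun p => (f (fst p), g (snd p))).
  intros [a b] [a' b'] E; simpl in E; injection E; intros.
  f_equal; auto.
Qed.

(** Hilbert's hotel: [m] moves to [e 0], every other [e n] to [e (S n)], and the remaining points
    stay. *)
Lemma le_card_insert {A : Type} (P : A -> Prop) (m : A) :
  infinite_card {x | P x} -> le_card {x | x = m \/ P x} {x | P x}.
Proof.
  intros [e he].
  apply le_card_of_rel with (fun x y =>
    (proj1_sig x = m /\ y = e 0) \/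
    (proj1_sig x <> m /\ ((exists n, proj1_sig x = proj1_sig (e n) /\ y = e (S n))
     \/ ((forall n, proj1_sig x <> proj1_sig (e n)) /\ proj1_sig x = proj1_sig y)))).
  - intros [x hx]; simpl; destruct (classic (x = m)) as [E|E]; [eauto|].
    destruct (classic (exists n, x = proj1_sig (e n))) as [[n hn]|N].
    + exists (e (S n)); right; eauto.
    + destruct hx as [hx|hx]; [contradiction|].
      exists (exist _ x hx); right; split; [exact E|right; split; [eauto|reflexivity]].
  - intros [x hx] [x' hx'] y H H'; apply subtype_eq; simpl in *.
    destruct H as [[E Ey]|[_ [(n & E & Ey)|[E Ey]]]],
      H' as [[E' Ey']|[_ [(n' & E' & Ey')|[E' Ey']]]]; try congruence;
    try (assert (F := eq_trans (eq_sym Ey) Ey'); apply he in F);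
    try discriminate; try (injection F; congruence).
Qed.

(** Goedel's order on pairs. Comparing maxima first bounds both coordinates throughout a segment by
    a single point [m]. *)
Definition max_lex {A : Type} (R : A -> A -> Prop) (p q : A * A) : Prop :=
  let mx p := if excluded_middle_informative (R (fst p) (snd p)) then snd p else fst p in
  slexprod _ _ R (slexprod _ _ R R) (mx p, p) (mx q, q).

Lemma max_lex_well_order {A : Type} (R : A -> A -> Prop) :
  strict_well_order R -> well_founded (max_lex R) /\
  (forall p q, max_lex R p q \/ p = q \/ max_lex R q p).
Proof.
  intros (wf & tr & tot); split.
  - unfold max_lex; apply wf_inverse_image with (f := fun p => (_, p)).
    apply wf_slexprod; [|apply wf_slexprod]; exact wf.
  - intros [a b] [a' b']; unfold max_lex.
    match goal with |- slexprod _ _ _ _ (?m, _) (?m', _) \/ _ =>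
      set (x := m); set (y := m') end.
    destruct (tot x y) as [h|[h|h]].
    + left; left; exact h.
    + rewrite h; destruct (tot a a') as [h1|[h1|h1]].
      * left; right; left; exact h1.
      * subst a'; destruct (tot b b') as [h2|[h2|h2]].
        -- left; right; right; exact h2.
        -- subst b'; right; left; reflexivity.
        -- right; right; right; right; exact h2.
      * right; right; right; left; exact h1.
    + right; right; left; exact h.
Qed.

Lemma max_lex_segment {A : Type} (R : A -> A -> Prop) (p : A * A) :
  strict_well_order R -> exists m, forall q, max_lex R q p ->
    (fst q = m \/ R (fst q) m) /\ (snd q = m \/ R (snd q) m).
Proof.
  intros (wf & tr & tot).
  exists (if excluded_middle_informative (R (fst p) (snd p)) then snd p else fst p).
  intros q H; unfold max_lex in H.
  match goal with |- context [_ = ?m] => set (m0 := m) in * end.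
  set (mq := if excluded_middle_informative (R (fst q) (snd q)) then snd q else fst q) in *.
  assert (Hq : (fst q = mq \/ R (fst q) mq) /\ (snd q = mq \/ R (snd q) mq)).
  { unfold mq; destruct (excluded_middle_informative (R (fst q) (snd q))); [tauto|].
    destruct (tot (fst q) (snd q)) as [h|[h|h]]; [contradiction| |]; auto. }
  assert (Hm : mq = m0 \/ R mq m0) by (inversion H; auto).
  destruct Hm as [<-|Hm]; [exact Hq|].
  destruct Hq as [[E1|h1] [E2|h2]]; try rewrite E1; try rewrite E2;
    split; right; eauto.
Qed.

Lemma square_of_segments {A : Type} (R : A -> A -> Prop) :
  strict_well_order R -> infinite_card A ->
  (forall a, infinite_card {b | R b a} ->
    le_card ({b | R b a} * {b | R b a}) {b | R b a}) ->
  le_card (A * A) A.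
Proof.
  intros wo inf sq.
  destruct (classic (exists a, le_card A {b | R b a})) as [[a le]|N].
  - apply le_card_trans with ({b | R b a} * {b | R b a})%type.
    + apply le_card_prod; exact le.
    + apply le_card_trans with {b | R b a}.
      * apply sq; apply le_card_trans with A; assumption.
      * exists (@proj1_sig _ _); apply subtype_eq.
  (* Here no segment of [A] is as large as [A]. A segment of the order on pairs lies in [D * D],
     which is finite or embeds in a segment of [A], so it cannot receive [A]. *)
  - destruct (max_lex_well_order R wo) as [wf tot].
    apply (le_card_of_segments (max_lex R) wf tot); intros p le.
    destruct (max_lex_segment R p wo) as [m hm].
    set (D := {z | z = m \/ R z m}).
    assert (leD : le_card A (D * D)).
    { apply le_card_trans with (1 := le).
      exists (fun q => (exist _ (fst (proj1_sig q)) (proj1 (hm _ (proj2_sig q))),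
                        exist _ (snd (proj1_sig q)) (proj2 (hm _ (proj2_sig q)))) : D * D).
      intros [[x y] hq] [[x' y'] hq'] E; apply subtype_eq; simpl in *.
      injection E; intros; congruence. }
    destruct (classic (infinite_card {b | R b m})) as [i|ni].
    + apply N; exists m; apply le_card_trans with (1 := leD).
      assert (le1 : le_card D {b | R b m}) by (apply le_card_insert; exact i).
      apply le_card_trans with (1 := le_card_prod _ _ _ _ le1 le1); auto.
    + apply (infinite_not_Finite A inf); apply le_card_Finite with (1 := leD).
      assert (Finite D).
      { destruct (NNPP (Finite {b | R b m})) as [l hl].
        { intros nF; apply ni, not_Finite_infinite, nF. }
        exists (exist _ m (or_introl eq_refl) ::
          map (fun b => exist _ (proj1_sig b) (or_intror (proj2_sig b))) l).
        intros [x hx]; destruct (classic (x = m)) as [E|E].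
        - left; apply subtype_eq; simpl; congruence.
        - right; destruct hx as [hx|hx]; [contradiction|].
          apply in_map_iff; exists (exist _ x hx); split; [|apply hl].
          apply subtype_eq; reflexivity. }
      apply Finite_prod; assumption.
Qed.

Lemma le_card_square (A : Type) : infinite_card A -> le_card (A * A) A.
Proof.
  intros inf; destruct (well_ordering A) as [R wo].
  assert (H : forall a, infinite_card {b | R b a} ->
    le_card ({b | R b a} * {b | R b a}) {b | R b a}).
  { refine (well_founded_ind (proj1 wo) _ _); intros a IH ia.
    apply square_of_segments with (fun x y => R (proj1_sig x) (proj1_sig y));
      [|exact ia|].
    - apply well_order_pullback; [exact wo|apply subtype_eq].
    - intros [b hb]; simpl; intros ib.
      (* A segment of a segment is a segment of the whole order, to which the induction hypothesis
         applies. *)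
      assert (E : eq_card {c : {c | R c a} | R (proj1_sig c) b} {c | R c b}).
      { apply Cantor_Bernstein.
        - exists (fun c => exist (fun c => R c b) (proj1_sig (proj1_sig c)) (proj2_sig c)).
          intros x y E; apply subtype_eq, subtype_eq; exact (f_equal (@proj1_sig _ _) E).
        - destruct wo as (_ & tr & _).
          exists (fun c => exist (fun c : {c | R c a} => R (proj1_sig c) b)
            (exist _ (proj1_sig c) (tr _ _ _ (proj2_sig c) hb)) (proj2_sig c)).
          intros x y E; apply subtype_eq.
          exact (f_equal (fun z => proj1_sig (proj1_sig z)) E). }
      pose proof (eq_card_le _ _ E) as le1; pose proof (eq_card_le _ _ (eq_card_sym _ _ E)) as le2.
      apply le_card_trans with (1 := le_card_prod _ _ _ _ le1 le1).
      apply le_card_trans with (2 := le2), IH; [exact hb|].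
      apply le_card_trans with (1 := ib), le1. }
  apply square_of_segments with R; assumption.
Qed.

Lemma le_card_mul (A B C : Type) :
  infinite_card C -> le_card A C -> le_card B C -> le_card (A * B) C.
Proof.
  intros i a b; apply le_card_trans with (C * C)%type.
  - apply le_card_prod; assumption.
  - apply le_card_square, i.
Qed.

Lemma le_card_add (A B C : Type) :
  infinite_card C -> le_card A C -> le_card B C -> le_card (A + B) C.
Proof.
  intros i [f hf] [g hg]; apply le_card_trans with (nat * C)%type.
  - exists (fun x => match x with inl a => (0, f a) | inr b => (1, g b) end).
    intros [a|b] [a'|b'] E; try discriminate; injection E; intros; f_equal; auto.
  - apply le_card_mul; auto using le_card_refl.
Qed.

Lemma le_card_list (A : Type) : infinite_card A -> le_card (list A) A.
Proof.
  intros i; destruct (le_card_square A i) as [p hp].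
  destruct (id i) as [f _]; pose (a0 := f 0).
  apply le_card_trans with (nat * A)%type.
  2: { apply le_card_mul; [exact i|exact i|apply le_card_refl]. }
  (* The code ends in the dummy [a0] and can be decoded only when the length is known, hence the
     pair below. *)
  set (code := fold_right (fun a c => p (a, c)) a0).
  exists (fun l => (length l, code l)).
  induction x as [|a l IH]; intros [|a' l'] E; try discriminate; [reflexivity|].
  simpl in E; injection E; intros E2 E1; apply hp in E2; injection E2; intros E3 <-.
  f_equal; apply IH; congruence.
Qed.

(** The product embeds in the square of the larger factor, which is finite or no larger than that
    factor. *)
Lemma not_le_card_mul (A B K : Type) : infinite_card K ->
  ~ le_card K A -> ~ le_card K B -> ~ le_card K (A * B).
Proof.
  intros i a b le.
  assert (H : forall D, ~ le_card K D -> ~ le_card K (D * D)).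
  { intros D d le2; destruct (classic (Finite D)) as [f|nf].
    - apply (infinite_not_Finite K i), (le_card_Finite _ _ le2), Finite_prod; assumption.
    - apply d, (le_card_trans _ _ _ le2), le_card_square, not_Finite_infinite, nf. }
  destruct (le_card_total A B) as [h|h].
  - apply (H B b), (le_card_trans _ _ _ le), le_card_prod; [exact h|apply le_card_refl].
  - apply (H A a), (le_card_trans _ _ _ le), le_card_prod; [apply le_card_refl|exact h].
Qed.

Lemma not_le_card_add (A B K : Type) : infinite_card K ->
  ~ le_card K A -> ~ le_card K B -> ~ le_card K (A + B).
Proof.
  intros i a b le.
  assert (H : forall D, ~ le_card K D -> ~ le_card K (D + D)).
  { intros D d le2; destruct (classic (Finite D)) as [f|nf].
    - apply (infinite_not_Finite K i), (le_card_Finite _ _ le2), Finite_sum; assumption.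
    - apply d, (le_card_trans _ _ _ le2), le_card_add; auto using le_card_refl.
      apply not_Finite_infinite, nf. }
  assert (M : forall D, le_card A D -> le_card B D -> le_card (A + B) (D + D)).
  { intros D [f hf] [g hg].
    exists (fun x => match x with inl u => inl (f u) | inr v => inr (g v) end).
    intros [u|u] [v|v] E; try discriminate; injection E; intros; f_equal; auto. }
  destruct (le_card_total A B) as [h|h].
  - apply (H B b), (le_card_trans _ _ _ le), M; [exact h|apply le_card_refl].
  - apply (H A a), (le_card_trans _ _ _ le), M; [apply le_card_refl|exact h].
Qed.

Lemma not_le_card_lists (A K : Type) (n : nat) : infinite_card K ->
  ~ le_card K A -> ~ le_card K {l : list A | length l = n}.
Proof.
  intros i a; induction n as [|n IH].
  - intros le; apply (infinite_not_Finite K i), (le_card_Finite _ _ le).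
    exists [exist (fun l => length l = 0) [] eq_refl]; intros [[|x l] h]; [|discriminate].
    left; apply subtype_eq; reflexivity.
  - intros le; apply (not_le_card_mul _ _ K i a IH), (le_card_trans _ _ _ le).
    apply le_card_of_rel with (fun (l : {l : list A | length l = S n}) p =>
      proj1_sig l = fst p :: proj1_sig (snd p)).
    + intros [[|x l] h]; [discriminate|].
      injection h; intros h'; exists (x, exist _ l h'); reflexivity.
    + intros l l' p E E'; apply subtype_eq; congruence.
Qed.

Lemma not_le_card_Finite (A K : Type) : infinite_card K -> Finite A -> ~ le_card K A.
Proof. intros i f le; exact (infinite_not_Finite K i (le_card_Finite _ _ le f)). Qed.

(* [small C S]: the set [S] has cardinality at most [C]; an injection defined
   on the ambient type avoids subtypes. *)
Definition small (C : Type) {X : Type} (S : X -> Prop) : Prop :=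
  exists g : X -> C, forall x y, S x -> S y -> g x = g y -> x = y.

Lemma small_of_rel {C X : Type} (S : X -> Prop) (R : X -> C -> Prop) :
  inhabited C -> (forall x, S x -> exists c, R x c) ->
  (forall x x' c, S x -> S x' -> R x c -> R x' c -> x = x') -> small C S.
Proof.
  intros [c0] ex inj.
  destruct (functional_choice (fun x c => S x -> R x c)) as [g hg].
  - intros x; destruct (classic (S x)) as [h|h].
    + destruct (ex x h) as [c hc]; eauto.
    + exists c0; tauto.
  - exists g; intros x y hx hy E; apply (inj x y (g x)); auto.
    rewrite E; auto.
Qed.

Lemma infinite_inhabited (C : Type) : infinite_card C -> inhabited C.
Proof. intros [f _]; exact (inhabits (f 0)). Qed.

Lemma le_card_small {C X : Type} (S : X -> Prop) :
  inhabited C -> le_card {x | S x} C -> small C S.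
Proof.
  intros iC [g hg].
  apply (small_of_rel S (fun x c => exists h, g (exist _ x h) = c) iC).
  - intros x hx; exists (g (exist _ x hx)), hx; reflexivity.
  - intros x x' c _ _ [h E] [h' E']; rewrite <- E' in E; apply hg in E.
    exact (f_equal (@proj1_sig _ _) E).
Qed.

Lemma small_subset {C X : Type} (S T : X -> Prop) :
  (forall x, S x -> T x) -> small C T -> small C S.
Proof. intros h [g hg]; exists g; auto. Qed.

Lemma small_le_trans {C D X : Type} (S : X -> Prop) :
  le_card C D -> small C S -> small D S.
Proof. intros [f hf] [g hg]; exists (fun x => f (g x)); auto. Qed.

Lemma small_union {C I X : Type} (P : I -> Prop) (S : I -> X -> Prop) :
  infinite_card C -> small C P -> (forall i, P i -> small C (S i)) ->
  small C (fun x => exists i, P i /\ S i x).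
Proof.
  intros inf [f hf] hS; pose proof (infinite_inhabited C inf) as [c0].
  destruct (le_card_square C inf) as [p hp].
  destruct (functional_choice (fun i (g : X -> C) =>
    P i -> forall x y, S i x -> S i y -> g x = g y -> x = y)) as [g hg].
  { intros i; destruct (classic (P i)) as [h|h].
    - destruct (hS i h) as [g hg]; exists g; auto.
    - exists (fun _ => c0); tauto. }
  apply small_of_rel with (fun x c => exists i, P i /\ S i x /\ c = p (f i, g i x)).
  - exact (inhabits c0).
  - intros x (i & hi & hx); eauto.
  - intros x x' c _ _ (i & Pi & Sx & E) (i' & Pi' & Sx' & E').
    rewrite E in E'; apply hp in E'; injection E'; intros E2 E1.
    apply hf in E1; auto; subst i'; eapply hg; eauto.
Qed.

(** * Coding by lists, and families of finite lists *)

Lemma map_inj_on {X Y : Type} (T : X -> Prop) (g : X -> Y) (l l' : list X) :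
  (forall x y, T x -> T y -> g x = g y -> x = y) ->
  (forall x, In x l -> T x) -> (forall x, In x l' -> T x) ->
  map g l = map g l' -> l = l'.
Proof.
  intros hg; revert l'; induction l as [|x l IH]; intros [|x' l'] hl hl' E;
    try discriminate; [reflexivity|].
  simpl in E; injection E; intros E2 E1; f_equal.
  - apply hg; auto; [apply hl|apply hl']; left; reflexivity.
  - apply IH; auto; intros y hy; [apply hl|apply hl']; right; exact hy.
Qed.

(** There are at most [C] pairs of a list from a small set and a number. This counts the points
    added to a closure and the points of a system. *)
Lemma small_of_lists {C X Y : Type} (T : Y -> Prop) (S : X -> Prop)
    (R : X -> list Y -> nat -> Prop) :
  infinite_card C -> small C T ->
  (forall x, S x -> exists l n, (forall y, In y l -> T y) /\ R x l n) ->
  (forall x x' l n, S x -> S x' -> R x l n -> R x' l n -> x = x') -> small C S.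
Proof.
  intros inf [g hg] ex inj.
  destruct (le_card_mul (list C) nat C inf (le_card_list C inf) inf) as [p hp].
  apply small_of_rel with (fun x c => exists l n,
    (forall y, In y l -> T y) /\ R x l n /\ c = p (map g l, n)).
  - apply infinite_inhabited, inf.
  - intros x hx; destruct (ex x hx) as (l & n & hl & h); eauto 6.
  - intros x x' c hx hx' (l & n & hl & h & E) (l' & n' & hl' & h' & E').
    rewrite E in E'; apply hp in E'; injection E'; intros <- E1.
    apply (map_inj_on T) in E1; auto; subst l'; eauto.
Qed.

Lemma lift_list {X : Type} (P : X -> Prop) (l : list X) :
  (forall x, In x l -> P x) -> exists l' : list {x | P x}, map (@proj1_sig _ _) l' = l.
Proof.
  induction l as [|x l IH]; intros h; [exists []; reflexivity|].
  destruct IH as [l' hl']; [intros y hy; apply h; right; exact hy|].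
  exists (exist _ x (h x (or_introl eq_refl)) :: l'); simpl; congruence.
Qed.

Lemma fin_listing (t : nat) :
  exists l : list (fin t), NoDup l /\ length l = t /\ Full l.
Proof.
  destruct (lift_list (fun m => m < t) (seq 0 t)) as [l hl].
  { intros m hm; apply in_seq in hm; lia. }
  exists l; split; [|split].
  - apply NoDup_map_inv with (f := @proj1_sig _ _); rewrite hl; apply seq_NoDup.
  - apply (f_equal (@length _)) in hl; rewrite length_map, length_seq in hl; exact hl.
  - intros [m hm]; assert (h : In m (map (@proj1_sig _ _) l)).
    { rewrite hl; apply in_seq; lia. }
    apply in_map_iff in h; destruct h as (m' & E & h).
    replace (exist _ m hm) with m'; [exact h|apply subtype_eq, E].
Qed.

(** Concluding equality of indices, not of sets, lets a duplicate-free list of more than [k] points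
    of a set identify its index; this is how sets are counted. *)
Definition almost_disjoint {I X : Type} (k : nat) (A : I -> list X) : Prop :=
  forall i j l, NoDup l -> incl l (A i) -> incl l (A j) -> k < length l -> i = j.

Definition decide (P : Prop) : bool :=
  if excluded_middle_informative P then true else false.

Lemma decide_true (P : Prop) : decide P = true <-> P.
Proof.
  unfold decide; destruct (excluded_middle_informative P); split; auto; discriminate.
Qed.

Definition select {X : Type} (P : X -> Prop) (l : list X) : list X :=
  filter (fun x => decide (P x)) l.

Lemma in_select {X : Type} (P : X -> Prop) (l : list X) (x : X) :
  In x (select P l) <-> In x l /\ P x.
Proof. unfold select; rewrite filter_In, decide_true; reflexivity. Qed.

Lemma select_length {X : Type} (P Q : X -> Prop) (l : list X) :
  (forall x, In x l -> P x \/ Q x) ->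
  length l <= length (select P l) + length (select Q l).
Proof.
  induction l as [|x l IH]; intros h; simpl; [lia|].
  assert (IH' := IH (fun y hy => h y (or_intror hy))).
  unfold select in *; simpl.
  assert (hx : decide (P x) = true \/ decide (Q x) = true).
  { rewrite !decide_true; apply h; left; reflexivity. }
  destruct (decide (P x)), (decide (Q x)); simpl in *; try lia.
Qed.

Lemma list_maximum {X B : Type} (R : B -> B -> Prop) (r : X -> B) (l : list X) :
  strict_well_order R -> l <> [] ->
  exists x, In x l /\ forall y, In y l -> r y = r x \/ R (r y) (r x).
Proof.
  intros (wf & tr & tot); induction l as [|x l IH]; [congruence|intros _].
  destruct l as [|x' l].
  - exists x; split; [left; reflexivity|intros y [<-|[]]; auto].
  - destruct IH as (z & hz & Hz); [discriminate|].
    destruct (tot (r x) (r z)) as [h|[h|h]].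
    + exists z; split; [right; exact hz|intros y [<-|hy]; auto].
    + exists z; split; [right; exact hz|intros y [<-|hy]; auto].
    + exists x; split; [left; reflexivity|intros y [<-|hy]; auto].
      destruct (Hz y hy) as [E|E]; [rewrite E; auto|right; eauto].
Qed.

(** * Upper bounds *)

(* The unique colour has to avoid the list [F i]; in the inductive step this list
   also contains the colours of the points of [A i] in lower layers. *)
Definition list_colorable (K : Type) (k s : nat) (C : Type) : Prop :=
  forall (X I : Type) (A : I -> list X) (F : I -> list K) (S : X -> Prop) (q : nat),
  small C S -> (forall i x, In x (A i) -> S x) -> (forall i, NoDup (A i)) ->
  (forall i, s <= length (A i)) -> almost_disjoint k A ->
  (forall i, length (F i) <= q) ->
  exists f : X -> K, forall i, exists x, In x (A i) /\ ~ In (f x) (F i) /\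
    forall y, In y (A i) -> f y = f x -> y = x.

(* Along an initial well-ordering of the points, the colour of the
   (k+1)-st point of each set is chosen outside the list of that set: fewer than
   [K] sets have a given point as their (k+1)-st one. *)
Lemma list_colorable_base (K : Type) (k : nat) :
  infinite_card K -> list_colorable K k (k + 1) K.
Proof.
  intros inf X I A F S q [e he] hS nd len ad hF.
  destruct (initial_well_ordering K) as (R & wo & seg).
  pose proof (infinite_inhabited K inf) as iK.
  pose proof wo as (wf & tr & tot).
  (* By almost disjointness [x] and [l] determine [i], so [b] and [k] earlier positions do. This
     bounds the number of lists [F i] to be avoided at [b]. *)
  set (cond := fun b i x l => In x (A i) /\ NoDup l /\ length l = k /\ incl l (A i) /\
    (forall y, In y l -> R (e y) b) /\ e x = b).
  destruct (wf_recursive_choice R (fun b g c => (forall b', R b' b -> g b' <> c) /\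
    forall i x l, cond b i x l -> ~ In c (F i)) wf iK) as [G hG].
  - intros b g; apply NNPP; intros N.
    (* The colours excluded at [b] are the earlier values and the entries of the lists [F i], each
       entry coded by [k] earlier positions and an index below [q]. *)
    assert (W : ~ le_card K
      ({b' | R b' b} + {l : list {b' | R b' b} | length l = k} * {m | m < q})).
    { apply not_le_card_add; [exact inf|apply seg|].
      apply not_le_card_mul; [exact inf|apply not_le_card_lists; auto|].
      apply not_le_card_Finite; [exact inf|].
      destruct (fin_listing q) as (l & _ & _ & h); exists l; exact h. }
    apply W; apply le_card_of_rel with (fun c w =>
      match w with
      | inl b' => g (proj1_sig b') = c
      | inr (v, m) => exists i x l, cond b i x l /\
          map e l = map (@proj1_sig _ _) (proj1_sig v) /\
          nth_error (F i) (proj1_sig m) = Some c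
      end).
    + intros c; apply NNPP; intros Nc; apply N; exists c; split.
      * intros b' h E; apply Nc; exists (inl (exist _ b' h)); exact E.
      * intros i x l hc hin; apply Nc.
        destruct (In_nth_error _ _ hin) as [m hm].
        assert (hmq : m < q).
        { apply Nat.lt_le_trans with (length (F i)); [|apply hF].
          apply nth_error_Some; congruence. }
        pose proof hc as (_ & _ & hl & _ & hR & _).
        destruct (lift_list (fun b' => R b' b) (map e l)) as [v hv].
        { intros c' hc'; apply in_map_iff in hc'; destruct hc' as (y & <- & hy); auto. }
        symmetry in hv.
        assert (lv : length v = k).
        { rewrite <- hl, <- (length_map e l), hv, length_map; reflexivity. }
        exists (inr (exist _ v lv, exist _ m hmq)), i, x, l; auto.
    + intros c c' [b'|[v m]]; [congruence|].
      intros (i & x & l & (h1 & h2 & h3 & h4 & h5 & h6) & h7 & h8)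
        (i' & x' & l' & (h1' & h2' & h3' & h4' & h5' & h6') & h7' & h8').
      assert (x = x') by (apply he; eauto; congruence); subst x'.
      assert (l = l').
      { apply (map_inj_on S e); eauto; congruence. }
      subst l'; assert (i = i').
      { apply (ad i i' (x :: l)).
        - constructor; [|exact h2]; intros hin; apply h5 in hin.
          rewrite h6 in hin; exact (well_order_irrefl R b wf hin).
        - intros y [<-|hy]; auto.
        - intros y [<-|hy]; auto.
        - simpl; lia. }
      subst i'; congruence.
  - intros b g g' c E [h1 h2]; split; [|exact h2].
    intros b' h; rewrite <- E by exact h; auto.
  - exists (fun x => G (e x)); intros i.
    (* Any [k + 1] points of the set will do: the last of them in the order avoids [F i]. Its colour
       is unique because all points of [S] get distinct colours. *)
    assert (lF : length (firstn (k + 1) (A i)) = k + 1).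
    { apply firstn_length_le, len. }
    destruct (list_maximum R e (firstn (k + 1) (A i)) wo) as (x & hx & hmax).
    { intros E; rewrite E in lF; simpl in lF; lia. }
    assert (sub : incl (firstn (k + 1) (A i)) (A i)).
    { intros y hy; rewrite <- (firstn_skipn (k + 1)); apply in_or_app; auto. }
    assert (ndF : NoDup (firstn (k + 1) (A i))).
    { apply NoDup_app_remove_r with (skipn (k + 1) (A i)).
      rewrite firstn_skipn; apply nd. }
    exists x; split; [|split].
    + apply sub, hx.
    + destruct (in_split _ _ hx) as (l1 & l2 & E).
      destruct (hG (e x)) as [_ h]; apply (h i x (l1 ++ l2)).
      rewrite E in ndF, hmax, sub, lF.
      pose proof (NoDup_remove _ _ _ ndF) as [nd1 nd2].
      assert (sub2 : incl (l1 ++ l2) (l1 ++ x :: l2)).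
      { intros y hy; apply in_app_or in hy; apply in_or_app; simpl; tauto. }
      rewrite length_app in lF; simpl in lF; repeat split; auto.
      * apply sub, in_or_app; right; left; reflexivity.
      * rewrite length_app; lia.
      * intros y hy; auto.
      * intros y hy; destruct (hmax y (sub2 y hy)) as [E1|h1]; [|exact h1].
        exfalso; apply nd2; replace x with y; [exact hy|].
        apply he; [| |exact E1]; eapply hS; apply sub; auto.
        apply in_or_app; right; left; reflexivity.
    + intros y hy E; apply he; eauto.
      destruct (tot (e y) (e x)) as [h|[h|h]]; [exfalso|exact h|exfalso].
      * exact (proj1 (hG (e x)) (e y) h E).
      * exact (proj1 (hG (e y)) (e x) h (eq_sym E)).
Qed.

(** A segment of an initial well-ordering is smaller than [B], hence at most [C], since [B] is the
    least cardinal above [C]. The endpoint is absorbed by the infinite [C]. *)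
Lemma successor_well_ordering (C B : Type) :
  infinite_card C -> is_succ_card C B ->
  exists R : B -> B -> Prop, strict_well_order R /\
    forall b, small C (fun b' => b' = b \/ R b' b).
Proof.
  intros inf [_ least]; destruct (initial_well_ordering B) as (R & wo & seg).
  exists R; split; [exact wo|]; intros b.
  assert (le : le_card {b' | R b' b} C).
  { apply NNPP; intros N; apply (seg b), least; split; [apply not_le_card|]; exact N. }
  apply le_card_small; [apply infinite_inhabited, inf|].
  apply le_card_trans with ({b' | R b' b} + nat)%type.
  2: apply le_card_add; auto.
  apply le_card_of_rel with (fun x y =>
    match y with inl b' => proj1_sig x = proj1_sig b' | inr _ => proj1_sig x = b end).
  - intros [x [h|h]]; [exists (inr 0); exact h|exists (inl (exist _ x h)); reflexivity].
  - intros x x' [y|n] E E'; apply subtype_eq; congruence.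
Qed.

Lemma small_or {C X : Type} (S T : X -> Prop) :
  infinite_card C -> small C S -> small C T -> small C (fun x => S x \/ T x).
Proof.
  intros inf hS hT.
  apply small_subset with (fun x => exists b : bool, True /\ (if b then S x else T x)).
  - intros x [h|h]; [exists true|exists false]; auto.
  - apply small_union; [exact inf| |intros [] _; assumption].
    destruct inf as [f hf]; exists (fun b : bool => if b then f 0 else f 1).
    intros [] [] _ _ E; auto; apply hf in E; discriminate.
Qed.

Section Closure.
Context {I X : Type} (k : nat) (A : I -> list X).

Fixpoint closure_level (S : X -> Prop) (n : nat) (x : X) : Prop :=
  match n with
  | 0 => S x
  | Datatypes.S m => closure_level S m x \/
      exists i l, NoDup l /\ k < length l /\ incl l (A i) /\
        (forall y, In y l -> closure_level S m y) /\ In x (A i)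
  end.

Definition closure (S : X -> Prop) (x : X) : Prop := exists n, closure_level S n x.

Lemma closure_level_le (S : X -> Prop) (m n : nat) (x : X) :
  m <= n -> closure_level S m x -> closure_level S n x.
Proof. induction 1; simpl; auto. Qed.

Lemma closure_closed (S : X -> Prop) (i : I) (l : list X) :
  NoDup l -> k < length l -> incl l (A i) -> (forall y, In y l -> closure S y) ->
  forall x, In x (A i) -> closure S x.
Proof.
  intros h1 h2 h3 h4 x hx.
  assert (H : exists n, forall y, In y l -> closure_level S n y).
  { clear - h4; induction l as [|y l IH]; [exists 0; intros y []|].
    destruct IH as [n hn]; [intros z hz; apply h4; right; exact hz|].
    destruct (h4 y (or_introl eq_refl)) as [m hm].
    exists (m + n); intros z [<-|hz].
    - apply closure_level_le with m; [lia|exact hm].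
    - apply closure_level_le with n; [lia|auto]. }
  destruct H as [n hn]; exists (Datatypes.S n); right; exists i, l; auto.
Qed.

Lemma closure_mono (S T : X -> Prop) (x : X) :
  (forall y, S y -> T y) -> closure S x -> closure T x.
Proof.
  intros h [n hn]; exists n; revert x hn; induction n as [|n IH]; simpl; auto.
  intros x [hx|(i & l & h1 & h2 & h3 & h4 & h5)]; [auto|].
  right; exists i, l; repeat split; auto.
Qed.

(** A set added in one round is determined by a list of more than [k] points of the previous level,
    and a new point by that list and its position in the set. *)
Lemma closure_small (C : Type) (S : X -> Prop) :
  infinite_card C -> almost_disjoint k A -> small C S -> small C (closure S).
Proof.
  intros inf ad hS.
  apply small_subset with (fun x => exists n, True /\ closure_level S n x).
  { intros x [n h]; eauto. }
  apply small_union; [exact inf| |].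
  { destruct inf as [f hf]; exists f; auto. }
  intros n _; induction n as [|n IH]; [exact hS|].
  apply small_or; [exact inf|exact IH|].
  apply small_of_lists with (T := closure_level S n) (R := fun x l m => exists i,
    NoDup l /\ k < length l /\ incl l (A i) /\ nth_error (A i) m = Some x);
    [exact inf|exact IH| |].
  - intros x (i & l & h1 & h2 & h3 & h4 & h5).
    destruct (In_nth_error _ _ h5) as [m hm]; exists l, m; eauto 7.
  - intros x x' l m _ _ (i & h1 & h2 & h3 & h4) (i' & h1' & h2' & h3' & h4').
    assert (i = i') by (apply (ad i i' l); auto); congruence.
Qed.

(** [r x] is the first [b] whose closed set [Z b] contains [x]. If more than [k] points of a set
    ranked below its top point, all of them would lie in [Z (r z)] for the highest such point [z];
    closedness would put the top point there too, contradicting its rank. *)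
Lemma layering (C B : Type) (R : B -> B -> Prop) (S : X -> Prop) (e : X -> B) :
  infinite_card C -> strict_well_order R ->
  (forall b, small C (fun b' => b' = b \/ R b' b)) ->
  (forall x y, S x -> S y -> e x = e y -> x = y) ->
  (forall i x, In x (A i) -> S x) -> (forall i, NoDup (A i)) ->
  (forall i, k < length (A i)) -> almost_disjoint k A ->
  exists r : X -> B, (forall b, small C (fun x => S x /\ r x = b)) /\
    forall i, exists b, (forall x, In x (A i) -> r x = b \/ R (r x) b) /\
      length (select (fun x => R (r x) b) (A i)) <= k.
Proof.
  intros inf wo seg inj hS nd len ad.
  pose proof wo as (wf & tr & tot).
  set (Z := fun b => closure (fun y => S y /\ (e y = b \/ R (e y) b))).
  assert (Zmono : forall b b' x, R b b' -> Z b x -> Z b' x).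
  { intros b b' x h; apply closure_mono; intros y [hy [E|hy']]; split; auto.
    - right; congruence.
    - right; eauto. }
  destruct (functional_choice (fun x b => S x -> Z b x /\
    forall b', Z b' x -> b = b' \/ R b b')) as [r hr].
  { intros x; destruct (classic (S x)) as [h|h]; [|exists (e x); tauto].
    destruct (well_order_least R (fun b => Z b x) wo) as (b & hb); [|eauto].
    exists (e x), 0; simpl; auto. }
  exists r; split.
  - intros b; apply small_subset with (Z b).
    + intros x [hx <-]; apply hr, hx.
    + apply closure_small; [exact inf|exact ad|].
      destruct (seg b) as [g hg]; exists (fun x => g (e x)).
      intros x y [hx hx'] [hy hy'] E; apply inj; auto.
  - intros i; destruct (list_maximum R r (A i) wo) as (x & hx & hmax).
    { intros E; specialize (len i); rewrite E in len; simpl in len; lia. }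
    exists (r x); split; [exact hmax|].
    apply Nat.nlt_ge; intros lt.
    destruct (list_maximum R r (select (fun y => R (r y) (r x)) (A i)) wo)
      as (z & hz & hzmax).
    { intros E; rewrite E in lt; simpl in lt; lia. }
    apply in_select in hz; destruct hz as [hz hzx].
    assert (Zx : Z (r z) x).
    { apply (closure_closed _ i (select (fun y => R (r y) (r x)) (A i))); auto.
      - apply NoDup_filter, nd.
      - intros y hy; apply in_select in hy; tauto.
      - intros y hy; pose proof hy as hy'; apply in_select in hy'.
        destruct (hr y (hS i y (proj1 hy'))) as [Zy _].
        destruct (hzmax y hy) as [E|h]; [rewrite <- E; exact Zy|].
        exact (Zmono _ _ _ h Zy). }
    destruct (hr x (hS i x hx)) as [_ h].
    destruct (h _ Zx) as [E|h'].
    + rewrite E in hzx; exact (well_order_irrefl R (r z) wf hzx).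
    + exact (well_order_irrefl R (r z) wf (tr _ _ _ hzx h')).
Qed.

End Closure.

(** The part of a set in its top layer keeps at least [s] points. The colours of its at most [k]
    lower points join the list to avoid, hence the bound [q + k]; avoiding them keeps the unique
    colour unique in the whole set. *)
Lemma list_colorable_step (K C B : Type) (k s : nat) :
  infinite_card K -> infinite_card C -> is_succ_card C B -> k < s ->
  list_colorable K k s C -> list_colorable K k (s + k) B.
Proof.
  intros infK inf suc ks IH X I A F S q [e he] hS nd len ad hF.
  destruct (successor_well_ordering C B inf suc) as (R & wo & seg).
  destruct (layering k A C B R S e inf wo seg he hS nd) as (r & small_layer & layer).
  { intros i; specialize (len i); lia. }
  { exact ad. }
  destruct (functional_choice _ layer) as [lev hlev].
  pose proof (infinite_inhabited K infK) as [c0].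
  set (old := fun (i : I) (g : B -> X -> K) =>
    map (fun y => g (r y) y) (select (fun y => R (r y) (lev i)) (A i))).
  (* The value at [b] is a colouring of all of [X], of which only the restriction to layer [b]
     enters the final colouring. *)
  destruct (wf_recursive_choice R (fun b (g : B -> X -> K) f =>
    forall i, lev i = b -> exists x, In x (A i) /\ r x = b /\
      ~ In (f x) (F i) /\ ~ In (f x) (old i g) /\
      forall y, In y (A i) -> r y = b -> f y = f x -> y = x) (proj1 wo)
    (inhabits (fun _ => c0))) as [G hG].
  - intros b g.
    set (new := fun i => select (fun x => r x = b) (A i)).
    destruct (IH X {i | lev i = b} (fun i => new (proj1_sig i))
      (fun i => F (proj1_sig i) ++ old (proj1_sig i) g)
      (fun x => S x /\ r x = b) (q + k)) as [f hf].
    + apply small_layer.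
    + intros i x hx; apply in_select in hx; destruct hx; eauto.
    + intros i; apply NoDup_filter, nd.
    + intros [i hi]; simpl; destruct (hlev i) as [h1 h2]; rewrite hi in h1, h2.
      pose proof (select_length _ _ _ h1) as h3; specialize (len i).
      unfold new; lia.
    + intros i j l h1 h2 h3 h4; apply subtype_eq, (ad _ _ l); auto.
      * intros y hy; apply h2, in_select in hy; tauto.
      * intros y hy; apply h3, in_select in hy; tauto.
    + intros [i hi]; simpl; unfold old; rewrite length_app, length_map.
      specialize (hF i); destruct (hlev i) as [_ h2]; lia.
    + exists f; intros i hi; destruct (hf (exist _ i hi)) as (x & h1 & h2 & h3).
      simpl in *; apply in_select in h1; exists x; repeat split; try tauto.
      * intros h; apply h2, in_or_app; auto.
      * intros h; apply h2, in_or_app; auto.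
      * intros y hy hyb; apply h3, in_select; auto.
  - intros b g g' f E H i hi; destruct (H i hi) as (x & h1 & h2 & h3 & h4 & h5).
    exists x; repeat split; auto; intros h; apply h4; revert h; unfold old.
    rewrite (map_ext_in (fun y => g' (r y) y) (fun y => g (r y) y)); auto.
    intros y hy; apply in_select in hy; rewrite E; [reflexivity|].
    rewrite <- hi; tauto.
  - exists (fun x => G (r x) x); intros i.
    destruct (hG (lev i) i eq_refl) as (x & h1 & h2 & h3 & h4 & h5).
    exists x; rewrite h2; repeat split; auto.
    intros y hy E; destruct (hlev i) as [h _].
    destruct (h y hy) as [hyb|hyb].
    + rewrite hyb in E; auto.
    + exfalso; apply h4; rewrite <- E; unfold old; apply in_map_iff.
      exists y; split; [reflexivity|]; apply in_select; auto.
Qed.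

Lemma list_colorable_le (K C D : Type) (k s : nat) :
  le_card D C -> list_colorable K k s C -> list_colorable K k s D.
Proof.
  intros le H X I A F S q hS; apply H; exact (small_le_trans _ le hS).
Qed.

Lemma succ_n_le_card (n : nat) (K L : Type) : succ_n n K L -> le_card K L.
Proof.
  revert L; induction n as [|n IH]; intros L; simpl; [apply eq_card_le|].
  intros (C & hC & [[le _] _]); apply le_card_trans with C; auto.
Qed.

Lemma succ_n_infinite (n : nat) (K L : Type) :
  infinite_card K -> succ_n n K L -> infinite_card L.
Proof.
  intros inf suc; apply le_card_trans with K; [exact inf|].
  exact (succ_n_le_card n K L suc).
Qed.

Lemma list_colorable_succ_n (K L : Type) (k m : nat) :
  infinite_card K -> succ_n m K L -> list_colorable K k (m * k + k + 1) L.
Proof.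
  intros inf; revert L; induction m as [|m IH]; intros L; simpl.
  - intros E; apply list_colorable_le with K.
    + apply eq_card_le, eq_card_sym, E.
    + apply list_colorable_base, inf.
  - intros (C & hC & suc).
    replace (k + m * k + k + 1) with (m * k + k + 1 + k) by lia.
    apply list_colorable_step with C; auto; [|lia].
    exact (succ_n_infinite m K C inf hC).
Qed.

(** * Set systems as families of lists *)

Lemma le_card_fin (a b : nat) : le_card (fin a) (fin b) -> a <= b.
Proof.
  intros [f hf]; destruct (fin_listing a) as (l & hl & len & _).
  assert (H : length (map (fun x => proj1_sig (f x)) l) <= length (seq 0 b)).
  2: { rewrite length_map, length_seq in H; lia. }
  apply NoDup_incl_length.
  - apply Injective_map_NoDup; [|exact hl]; intros x y E; apply hf, subtype_eq, E.
  - intros m hm; apply in_map_iff in hm; destruct hm as (x & <- & _).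
    apply in_seq; pose proof (proj2_sig (f x)); simpl in *; lia.
Qed.

Lemma fin_le_card (a b : nat) : a <= b -> le_card (fin a) (fin b).
Proof.
  intros le; exists (fun m : fin a => exist (fun n => n < b) (proj1_sig m)
    (Nat.lt_le_trans _ _ _ (proj2_sig m) le)).
  intros x y E; apply subtype_eq; exact (f_equal (@proj1_sig _ _) E).
Qed.

Lemma card_list {X : Type} (l : list X) :
  NoDup l -> eq_card {x | In x l} (fin (length l)).
Proof.
  intros nd.
  destruct (functional_choice (fun (x : {x | In x l}) (m : fin (length l)) =>
    nth_error l (proj1_sig m) = Some (proj1_sig x))) as [f hf].
  { intros [x hx]; destruct (In_nth_error _ _ hx) as [m hm].
    assert (h : m < length l) by (apply nth_error_Some; congruence).
    exists (exist _ m h); exact hm. }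
  apply eq_card_of_bijection with f.
  - intros x y E; apply subtype_eq; pose proof (hf x); pose proof (hf y).
    rewrite E in *; congruence.
  - intros [m hm].
    destruct (nth_error l m) as [x|] eqn:E; [|apply nth_error_Some in E; [tauto|exact hm]].
    exists (exist _ x (nth_error_In _ _ E)); apply subtype_eq; simpl.
    specialize (hf (exist _ x (nth_error_In _ _ E))); simpl in hf.
    apply (proj1 (NoDup_nth_error l) nd); [|congruence].
    apply nth_error_Some; congruence.
Qed.

Lemma list_of_card {X : Type} (S : X -> Prop) (t : nat) : eq_card {x | S x} (fin t) ->
  exists l, NoDup l /\ length l = t /\ forall x, In x l <-> S x.
Proof.
  intros (f & g & gf & fg); destruct (fin_listing t) as (l & nd & len & full).
  exists (map (fun m => proj1_sig (g m)) l); split; [|split].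
  - apply Injective_map_NoDup; [|exact nd].
    intros m n E; apply subtype_eq in E; rewrite <- (fg m), <- (fg n), E; reflexivity.
  - rewrite length_map; exact len.
  - intros x; rewrite in_map_iff; split.
    + intros (m & <- & _); apply proj2_sig.
    + intros h; exists (f (exist _ x h)); rewrite gf; auto.
Qed.

Lemma cf_coloring_iff {X I P : Type} (A : I -> X -> Prop) (f : X -> P) :
  cf_coloring X I P A f <->
  forall i, exists x, A i x /\ forall y, A i y -> f y = f x -> y = x.
Proof.
  split; intros H i.
  - destruct (H i) as (c & u & v & vu & _).
    exists (proj1_sig (v tt)); destruct (proj2_sig (v tt)) as [h1 h2].
    split; [exact h1|]; intros y hy E.
    assert (h : A i y /\ f y = c) by (split; congruence).
    assert (F : v (u (exist _ y h)) = exist _ y h) by apply vu.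
    destruct (u (exist _ y h)); rewrite F; reflexivity.
  - destruct (H i) as (x & hx & ux); exists (f x).
    exists (fun _ => tt), (fun _ => exist _ x (conj hx eq_refl)); split.
    + intros [y [hy E]]; apply subtype_eq; simpl; symmetry; auto.
    + intros []; reflexivity.
Qed.

Lemma cf_colorable_le {X I P Q : Type} (A : I -> X -> Prop) :
  le_card P Q -> cf_colorable X I P A -> cf_colorable X I Q A.
Proof.
  intros [g hg] [f hf]; exists (fun x => g (f x)).
  apply cf_coloring_iff; intros i.
  destruct (proj1 (cf_coloring_iff A f) hf i) as (x & hx & ux); eauto.
Qed.

Lemma system_lists {L X I : Type} {t k : nat} {A : I -> X -> Prop} :
  system L t (k + 1) X I A -> exists B : I -> list X,
    (forall i x, In x (B i) <-> A i x) /\ (forall i, NoDup (B i)) /\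
    (forall i, length (B i) = t) /\ almost_disjoint k B.
Proof.
  intros (_ & _ & _ & card & ad).
  destruct (functional_choice _ (fun i => list_of_card _ _ (card i))) as [B hB].
  exists B; split; [apply hB|split; [apply hB|split; [apply hB|]]].
  intros i j l nd hi hj lt; apply NNPP; intros ne.
  apply (ad i j ne), le_card_trans with (fin (length l)).
  - apply fin_le_card; lia.
  - apply le_card_trans with (1 := eq_card_le _ _ (eq_card_sym _ _ (card_list l nd))).
    exists (fun x => exist (fun x => A i x /\ A j x) (proj1_sig x)
      (conj (proj1 (proj2 (proj2 (hB i)) _) (hi _ (proj2_sig x)))
            (proj1 (proj2 (proj2 (hB j)) _) (hj _ (proj2_sig x))))).
    intros x y E; apply subtype_eq; exact (f_equal (@proj1_sig _ _) E).
Qed.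

Lemma cf_colorable_succ_n (K L : Type) (k m t : nat) :
  infinite_card K -> succ_n m K L -> (m + 1) * k < t ->
  forall (X I : Type) (A : I -> X -> Prop),
    system L t (k + 1) X I A -> cf_colorable X I K A.
Proof.
  intros inf suc lt X I A sys.
  destruct (system_lists sys) as (B & hB & nd & len & ad).
  destruct sys as (IL & _ & cover & _).
  pose proof (succ_n_infinite m K L inf suc) as infL.
  destruct (list_colorable_succ_n K L k m inf suc X I B (fun _ => []) (fun _ => True) 0)
    as [f hf]; auto.
  (* Every point lies in some set, so an index and a position code it: there are at most [L]
     points. *)
  - apply small_of_lists with (T := fun _ : I => True)
      (R := fun x l n => exists i, l = [i] /\ nth_error (B i) n = Some x).
    + exact infL.
    + destruct (eq_card_le _ _ IL) as [g hg]; exists g; auto.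
    + intros x _; destruct (cover x) as [i hi]; apply hB in hi.
      destruct (In_nth_error _ _ hi) as [n hn]; exists [i], n; eauto.
    + intros x x' l n _ _ (i & -> & h) (i' & E & h'); injection E; intros <-.
      congruence.
  - intros i; rewrite len; lia.
  - exists f; apply cf_coloring_iff; intros i.
    destruct (hf i) as (x & h1 & _ & h2); exists x; split; [apply hB, h1|].
    intros y hy; apply h2, hB, hy.
Qed.

(** * Lower bounds for infinitely many colours *)

Lemma le_card_powerset (A B : Type) :
  le_card A B -> le_card (A -> Prop) (B -> Prop).
Proof.
  intros [f hf]; exists (fun S b => exists a, f a = b /\ S a).
  intros S T E; apply functional_extensionality; intros a.
  apply propositional_extensionality; pose proof (equal_f E (f a)) as Ea; simpl in Ea.
  split; intros h.
  - assert (H : exists a', f a' = f a /\ S a') by eauto.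
    rewrite Ea in H; destruct H as (a' & Ea' & h'); apply hf in Ea'; congruence.
  - assert (H : exists a', f a' = f a /\ T a') by eauto.
    rewrite <- Ea in H; destruct H as (a' & Ea' & h'); apply hf in Ea'; congruence.
Qed.

Lemma Cantor (A : Type) : lt_card A (A -> Prop).
Proof.
  split.
  - exists (fun a b => a = b); intros x y E.
    rewrite (equal_f E y); reflexivity.
  - intros [f hf]; pose (D := fun a => exists S, f S = a /\ ~ S a).
    assert (H : D (f D) <-> ~ D (f D)); [|tauto].
    split.
    + intros (S & E & h); apply hf in E; subst S; exact h.
    + intros h; exists D; auto.
Qed.

(** The exponent rule: a function [d] is coded by the binary relation on [C] that joins [e j] to the
    members of [h (d j)]. *)
Lemma le_card_functions (J Y C : Type) : infinite_card C ->
  le_card J C -> le_card Y (C -> Prop) -> le_card (J -> Y) (C -> Prop).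
Proof.
  intros inf [e he] [h hh]; apply le_card_trans with (C * C -> Prop).
  2: apply le_card_powerset, le_card_square, inf.
  exists (fun d p => exists j, e j = fst p /\ h (d j) (snd p)).
  intros d d' E; apply functional_extensionality; intros j; apply hh.
  apply functional_extensionality; intros c; apply propositional_extensionality.
  pose proof (equal_f E (e j, c)) as Ej; simpl in Ej; split; intros H.
  - assert (H' : exists j', e j' = e j /\ h (d j') c) by eauto.
    rewrite Ej in H'; destruct H' as (j' & E' & H'); apply he in E'; congruence.
  - assert (H' : exists j', e j' = e j /\ h (d' j') c) by eauto.
    rewrite <- Ej in H'; destruct H' as (j' & E' & H'); apply he in E'; congruence.
Qed.

Lemma GCH_is_succ_powerset (C : Type) :
  GCH -> infinite_card C -> is_succ_card C (C -> Prop).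
Proof.
  intros gch inf; split; [apply Cantor|]; intros D [le nle].
  destruct (le_card_total (C -> Prop) D) as [h|h]; [exact h|].
  destruct (gch C inf D le h) as [E|E].
  - exfalso; apply nle, eq_card_le, eq_card_sym, E.
  - apply eq_card_le, eq_card_sym, E.
Qed.

Lemma GCH_powerset_le (C L : Type) :
  GCH -> infinite_card C -> is_succ_card C L -> le_card (C -> Prop) L.
Proof.
  intros gch inf [lt _]; apply (GCH_is_succ_powerset C gch inf), lt.
Qed.

Lemma list_le_card (A B : Type) : le_card A B -> le_card (list A) (list B).
Proof.
  intros [f hf]; exists (map f); intros l l'.
  apply (map_inj_on (fun _ => True)); auto.
Qed.

Lemma small_list {C X : Type} (l : list X) : infinite_card C -> small C (fun x => In x l).
Proof.
  intros inf; pose proof (infinite_inhabited C inf) as iC; destruct inf as [g hg].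
  apply (small_of_rel _ (fun x c => exists n, nth_error l n = Some x /\ c = g n) iC).
  - intros x hx; destruct (In_nth_error _ _ hx) as [n hn]; eauto.
  - intros x x' c _ _ (n & h & E) (n' & h' & E'); rewrite E in E'; apply hg in E'.
    congruence.
Qed.

(* The next step adds to [B j] one point of each colour in [F j]; as these are
   the colours of the points [b j], all colours in the defeating set are then
   repeated. So the exemption for [b j] when [e] holds matters for the base only. *)
Definition labelled_system (e : Prop) (P : Type) (k t : nat) (C : Type) : Prop :=
  exists (X J : Type) (B b : J -> list X) (F : J -> list P),
  le_card X C /\ le_card J C /\
  (forall j, NoDup (B j) /\ length (B j) = t /\ length (b j) = k /\ incl (b j) (B j)) /\
  almost_disjoint k B /\
  forall f : X -> P, exists j, map f (b j) = F j /\
    forall x, In x (B j) -> (e /\ In x (b j)) \/ exists y, In y (B j) /\ y <> x /\ f y = f x.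

(** The index is the label: the same set is listed once for every list of colours, and [f] selects
    the index [map f (b j)]. Almost disjointness survives because the set has at most [k] points.
    Padding with [0] gives [b] its length [k], and every point is exempted. *)
Lemma labelled_system_base (P : Type) (k s : nat) :
  infinite_card P -> 1 <= s <= k -> labelled_system True P k s P.
Proof.
  intros inf hs.
  exists nat, (list P), (fun _ => seq 0 s), (fun _ => seq 0 s ++ repeat 0 (k - s)),
    (fun F => F).
  split; [exact inf|split; [apply le_card_list, inf|split; [|split]]].
  - intros _; rewrite length_app, length_seq, repeat_length.
    repeat split; [apply seq_NoDup|lia|].
    intros x hx; apply in_app_or in hx; destruct hx as [hx|hx]; [exact hx|].
    apply repeat_spec in hx; apply in_seq; lia.
  - intros F F' l nd h _ lt.
    pose proof (NoDup_incl_length nd h) as le; rewrite length_seq in le; lia.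
  - intros f; eexists; split; [reflexivity|].
    intros x hx; left; split; [exact I|apply in_or_app; auto].
Qed.

(* The new points are [L] copies of the old system. The copy number [a] guesses
   a family [g a] of pairwise disjoint [k]-sets in the previous copies, one for
   each old set, to be added to the old sets in that copy. A colouring [f] is
   defeated by a guess [d] with [map f (d j) = F j] for all labels [F j]
   consisting of colours used more than [C] times. *)
Lemma labelled_system_step (P : Type) (k t : nat) (C L : Type) :
  GCH -> infinite_card C -> le_card P C -> is_succ_card C L -> 0 < t ->
  labelled_system True P k t C -> labelled_system False P k (t + k) L.
Proof.
  intros gch inf leP suc t0 (X & J & B & b & F & leX & leJ & hB & ad & H).
  destruct (successor_well_ordering C L inf suc) as (R & wo & seg).
  pose proof wo as (wf & tr & tot).
  pose proof (GCH_powerset_le C L gch inf suc) as powL.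
  destruct suc as [[leCL nleCL] leastL].
  assert (infL : infinite_card L) by (apply le_card_trans with C; assumption).
  assert (leX' : le_card (L * X) L).
  { apply le_card_mul; [exact infL|apply le_card_refl|].
    apply le_card_trans with C; assumption. }
  (* There are at most 2^C guesses, hence at most [L]. Numbering pairs of a guess and a point of [L]
     makes each guess recur in [L] many copies, so that no small set of copies exhausts them. *)
  destruct (le_card_mul (J -> list (L * X)) L L infL) as [code hcode];
    [|apply le_card_refl|].
  { apply le_card_trans with (2 := powL), le_card_functions; [exact inf|exact leJ|].
    apply le_card_trans with (1 := list_le_card _ _ leX').
    apply le_card_trans with (1 := le_card_list L infL), leastL, Cantor. }
  destruct (functional_choice (fun a d => forall d' y, code (d', y) = a -> d = d'))
    as [g hg].
  { intros a; destruct (classic (exists d y, code (d, y) = a)) as [(d & y & E)|N].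
    - exists d; intros d' y' E'; rewrite <- E' in E; apply hcode in E; congruence.
    - exists (fun _ => []); intros d' y E; exfalso; eauto. }
  assert (guess : forall d (T : L -> Prop), small C T -> exists a, g a = d /\ ~ T a).
  { intros d T [h hh]; apply NNPP; intros N; apply nleCL.
    assert (HT : forall y, T (code (d, y))).
    { intros y; apply NNPP; intros nT; apply N; exists (code (d, y)); split; eauto. }
    exists (fun y => h (code (d, y))); intros x y E; apply hh in E; auto.
    apply hcode in E; congruence. }
  (* Only valid guesses yield sets. The last condition keeps two sets of one copy from sharing added
     points. *)
  set (ok := fun (a : L) (j : J) => NoDup (g a j) /\ length (g a j) = k /\
    (forall p, In p (g a j) -> R (fst p) a) /\
    (forall j' p, In p (g a j) -> In p (g a j') -> j = j')).
  exists (L * X)%type, {q | ok (fst q) (snd q)},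
    (fun q => map (pair (fst (proj1_sig q))) (B (snd (proj1_sig q))) ++
      g (fst (proj1_sig q)) (snd (proj1_sig q))),
    (fun q => map (pair (fst (proj1_sig q))) (b (snd (proj1_sig q)))),
    (fun q => F (snd (proj1_sig q))).
  split; [exact leX'|split; [|split; [|split]]].
  - apply le_card_trans with (L * J)%type.
    + exists (@proj1_sig _ _); apply subtype_eq.
    + apply le_card_mul; [exact infL|apply le_card_refl|].
      apply le_card_trans with C; assumption.
  - intros [[a j] (h1 & h2 & h3 & h4)]; simpl in *.
    destruct (hB j) as (n1 & n2 & n3 & n4).
    rewrite length_app, !length_map; repeat split; try lia.
    + apply NoDup_app; [|exact h1|].
      * apply Injective_map_NoDup; [|exact n1]; intros x y E; congruence.
      * intros p hp hp'; apply in_map_iff in hp; destruct hp as (x & <- & _).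
        apply h3 in hp'; exact (well_order_irrefl R a wf hp').
    + intros p hp; apply in_or_app; left; revert hp; apply incl_map, n4.
  - intros [[a j] (h1 & h2 & h3 & h4)] [[a' j'] (h1' & h2' & h3' & h4')] l nd hl hl' lt.
    apply subtype_eq; simpl in *.
    assert (in_copy : forall p, In p l -> (fst p = a /\ In (snd p) (B j)) \/ In p (g a j)).
    { intros p hp; apply hl, in_app_or in hp; destruct hp as [hp|hp]; auto.
      apply in_map_iff in hp; destruct hp as (x & <- & hx); auto. }
    assert (in_copy' :
      forall p, In p l -> (fst p = a' /\ In (snd p) (B j')) \/ In p (g a' j')).
    { intros p hp; apply hl', in_app_or in hp; destruct hp as [hp|hp]; auto.
      apply in_map_iff in hp; destruct hp as (x & <- & hx); auto. }
    clear hl hl'.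
    (* A point common to sets of different copies does not lie beyond the earlier copy, so it is one
       of the [k] added points of the later set. *)
    destruct (tot a a') as [h|[h|h]].
    + exfalso; assert (sub : incl l (g a' j')).
      { intros p hp; destruct (in_copy' p hp) as [[E _]|h']; [exfalso|exact h'].
        rewrite <- E in h; destruct (in_copy p hp) as [[E' _]|h''].
        - rewrite E' in h; exact (well_order_irrefl R a wf h).
        - exact (well_order_irrefl R a wf (tr _ _ _ h (h3 p h''))). }
      pose proof (NoDup_incl_length nd sub); lia.
    + subst a'; destruct (classic (j = j')) as [E|ne]; [congruence|exfalso].
      assert (all : forall p, In p l -> fst p = a /\ In (snd p) (B j) /\ In (snd p) (B j')).
      { intros p hp; destruct (in_copy p hp) as [[E1 i1]|i1],
          (in_copy' p hp) as [[E2 i2]|i2]; auto; exfalso.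
        - apply h3' in i2; rewrite E1 in i2; exact (well_order_irrefl R a wf i2).
        - apply h3 in i1; rewrite E2 in i1; exact (well_order_irrefl R a wf i1).
        - eauto. }
      apply ne, (ad j j' (map snd l)).
      * apply NoDup_map_NoDup_ForallPairs; [|exact nd].
        intros [a1 x1] [a2 x2] i1 i2 E; apply all in i1, i2; simpl in *.
        destruct i1, i2; congruence.
      * intros x hx; apply in_map_iff in hx; destruct hx as (p & <- & hp).
        apply all, hp.
      * intros x hx; apply in_map_iff in hx; destruct hx as (p & <- & hp).
        apply all, hp.
      * rewrite length_map; exact lt.
    + exfalso; assert (sub : incl l (g a j)).
      { intros p hp; destruct (in_copy p hp) as [[E _]|h']; [exfalso|exact h'].
        rewrite <- E in h; destruct (in_copy' p hp) as [[E' _]|h''].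
        - rewrite E' in h; exact (well_order_irrefl R a' wf h).
        - exact (well_order_irrefl R a' wf (tr _ _ _ h (h3' p h''))). }
      pose proof (NoDup_incl_length nd sub); lia.
  - intros f.
    destruct (infinite_inhabited L infL) as [a0].
    assert (iX : inhabited X).
    { destruct (classic (inhabited X)) as [h|nX]; [exact h|exfalso].
      destruct (H (fun x => False_rect P (nX (inhabits x)))) as [j _].
      destruct (hB j) as (_ & h & _); destruct (B j) as [|x l]; [simpl in h; lia|].
      exact (nX (inhabits x)). }
    destruct iX as [x0].
    set (big := fun c => ~ small C (fun p => f p = c)).
    destruct (functional_choice (fun c (e : C -> L * X) => big c ->
      (forall u v, e u = e v -> u = v) /\ forall u, f (e u) = c)) as [e he].
    { intros c; destruct (classic (big c)) as [h|h].
      2: exists (fun _ => (a0, x0)); tauto.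
      assert (le : le_card C {p | f p = c}).
      { apply not_le_card; intros le; apply h.
        apply le_card_small; [apply infinite_inhabited, inf|exact le]. }
      destruct le as [e he]; exists (fun u => proj1_sig (e u)); intros _; split.
      - intros u v E; apply he, subtype_eq, E.
      - intros u; exact (proj2_sig (e u)). }
    destruct (le_card_mul J nat C inf leJ inf) as [cj hcj].
    set (c0 := f (a0, x0)).
    set (allbig := fun j => forall c, In c (F j) -> big c).
    (* The position [cj (j, m)] within the colour class makes the points chosen for different pairs
       [(j, m)] distinct, even when labels share or repeat colours. Labels with a colour that is not
       big get a dummy; they will not occur in the selected copy. *)
    set (d := fun j => if decide (allbig j)
      then map (fun m => e (nth m (F j) c0) (cj (j, m))) (seq 0 (length (F j)))
      else []).
    assert (in_d : forall j p, In p (d j) -> exists m, big (nth m (F j) c0) /\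
      p = e (nth m (F j) c0) (cj (j, m))).
    { intros j p hp; unfold d in hp.
      destruct (decide (allbig j)) eqn:D; [|destruct hp].
      apply (proj1 (decide_true _)) in D; apply in_map_iff in hp; destruct hp as (m & <- & hm).
      exists m; split; [|reflexivity]; apply D, nth_In; apply in_seq in hm; lia. }
    assert (e_inj : forall c c' u u', big c -> big c' -> e c u = e c' u' -> u = u').
    { intros c c' u u' h h' E; destruct (he c h) as [i1 i2], (he c' h') as [_ i2'].
      assert (c = c') by (rewrite <- (i2 u), <- (i2' u'), E; reflexivity).
      subst c'; auto. }
    (* The copy must come after all guessed points and contain only big colours. At most [C] guessed
       points exclude a segment each, and at most [C] points have a colour that is not big. *)
    set (bad1 := fun a => exists j, True /\
      exists p, In p (d j) /\ (a = fst p \/ R a (fst p))).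
    set (bad2 := fun a => exists x, ~ big (f (a, x))).
    destruct (guess d (fun a => bad1 a \/ bad2 a)) as (a & ga & nbad).
    { apply small_or; [exact inf| |].
      - apply small_union; [exact inf| |].
        + destruct leJ as [h hh]; exists h; auto.
        + intros j _; apply small_union; [exact inf|apply small_list, inf|].
          intros p _; apply seg.
      - assert (S2 : small C (fun p => exists c, ~ big c /\ f p = c)).
        { apply small_union; [exact inf| |].
          - destruct leP as [h hh]; exists h; auto.
          - intros c hc; apply NNPP, hc. }
        destruct S2 as [h hh].
        apply small_of_rel with (fun a c => exists x, ~ big (f (a, x)) /\ c = h (a, x)).
        + apply infinite_inhabited, inf.
        + intros a [x hx]; eauto.
        + intros a a' c _ _ (x & hx & E) (x' & hx' & E'); rewrite E in E'.
          apply hh in E'; eauto; congruence. }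
    destruct (H (fun x => f (a, x))) as (j & hF & hj).
    assert (jbig : allbig j).
    { intros c hc; rewrite <- hF in hc; apply in_map_iff in hc.
      destruct hc as (x & <- & _); apply NNPP; intros N; apply nbad; right.
      exists x; exact N. }
    assert (dj : d j = map (fun m => e (nth m (F j) c0) (cj (j, m)))
      (seq 0 (length (F j)))).
    { unfold d; rewrite (proj2 (decide_true _) jbig); reflexivity. }
    assert (colors : map f (d j) = F j).
    { rewrite dj, map_map; apply nth_ext with c0 c0.
      - rewrite length_map, length_seq; reflexivity.
      - intros m hm; rewrite length_map, length_seq in hm.
        rewrite nth_indep with (d' := f (e (nth 0 (F j) c0) (cj (j, 0))))
          by (rewrite length_map, length_seq; exact hm).
        rewrite map_nth with (f := fun m => f (e (nth m (F j) c0) (cj (j, m)))).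
        rewrite seq_nth by exact hm; simpl.
        apply he, jbig, nth_In, hm. }
    assert (below : forall p, In p (d j) -> R (fst p) a).
    { intros p hp; destruct (tot (fst p) a) as [h|h]; [exact h|].
      exfalso; apply nbad; left; exists j; split; [exact I|]; exists p.
      split; [exact hp|]; destruct h; auto. }
    assert (hok : ok (fst (a, j)) (snd (a, j))).
    { simpl; unfold ok; rewrite ga; split; [|split; [|split]].
      - rewrite dj; apply NoDup_map_NoDup_ForallPairs; [|apply seq_NoDup].
        intros m m' hm hm' E; apply in_seq in hm, hm'; apply e_inj in E.
        + apply hcj in E; congruence.
        + apply jbig, nth_In; lia.
        + apply jbig, nth_In; lia.
      - rewrite <- (length_map f), colors, <- hF, length_map; apply hB.
      - exact below.
      - intros j' p hp hp'; destruct (in_d j p hp) as (m & h1 & E1),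
          (in_d j' p hp') as (m' & h1' & E1'); rewrite E1 in E1'.
        apply e_inj in E1'; auto; apply hcj in E1'; congruence. }
    exists (exist _ (a, j) hok); simpl; rewrite ga; split.
    { rewrite map_map; exact hF. }
    (* The colour of an exempted point belongs to the label and reappears on an added point; an
       added point repeats the colour of a point of [b j]. *)
    intros p hp; right; apply in_app_or in hp; destruct hp as [hp|hp].
    + apply in_map_iff in hp; destruct hp as (x & <- & hx).
      destruct (hj x hx) as [[_ hx']|(y & hy & ne & E)].
      * assert (hc : In (f (a, x)) (map f (d j))).
        { rewrite colors, <- hF; apply (in_map (fun x => f (a, x))), hx'. }
        apply in_map_iff in hc; destruct hc as (y & E & hy).
        exists y; split; [apply in_or_app; auto|split; [|exact E]].
        intros ->; apply below in hy; exact (well_order_irrefl R a wf hy).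
      * exists (a, y); split; [|split; [congruence|exact E]].
        apply in_or_app; left; apply in_map, hy.
    + assert (hc : In (f p) (map (fun x => f (a, x)) (b j))).
      { rewrite hF, <- colors; apply in_map, hp. }
      apply in_map_iff in hc; destruct hc as (x & E & hx).
      exists (a, x); split; [|split; [|exact E]].
      * apply in_or_app; left; apply in_map; apply (hB j); exact hx.
      * intros <-; apply below in hp; exact (well_order_irrefl R a wf hp).
Qed.

(** The induction starts after one step, since only then is the exemption gone; before each further
    step [False] is weakened to [True]. *)
Lemma labelled_system_succ_n (P L : Type) (k s i : nat) :
  GCH -> infinite_card P -> 1 <= s <= k -> succ_n (S i) P L ->
  labelled_system False P k (S i * k + s) L.
Proof.
  intros gch inf hs; revert L; induction i as [|i IH]; intros L (C & hC & suc).
  - replace (1 * k + s) with (s + k) by lia.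
    apply labelled_system_step with C; auto; try lia.
    + exact (succ_n_infinite 0 P C inf hC).
    + apply eq_card_le, hC.
    + destruct (labelled_system_base P k s inf hs)
        as (X & J & B & b & F & leX & leJ & h).
      exists X, J, B, b, F; split; [|split; [|exact h]].
      * apply le_card_trans with P; [exact leX|apply eq_card_le, hC].
      * apply le_card_trans with P; [exact leJ|apply eq_card_le, hC].
  - replace (S (S i) * k + s) with (S i * k + s + k) by lia.
    apply labelled_system_step with C; auto; try lia.
    + exact (succ_n_infinite (S i) P C inf hC).
    + exact (succ_n_le_card (S i) P C hC).
    + destruct (IH C hC) as (X & J & B & b & F & h1 & h2 & h3 & h4 & h5).
      exists X, J, B, b, F; repeat (split; [assumption|]).
      intros f; destruct (h5 f) as (j & h6 & h7); exists j; split; [exact h6|].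
      intros x hx; destruct (h7 x hx) as [[[] _]|h8]; auto.
Qed.

(** * Lower bounds for finitely many colours *)

Lemma Finite_functions (E V : Type) : Finite E -> Finite V -> Finite (E -> V).
Proof.
  intros [le he] [lv hv].
  assert (H : forall l : list E, exists fs : list (E -> V), forall g, exists f,
    In f fs /\ forall e, In e l -> f e = g e).
  { induction l as [|e l [fs hfs]].
    - destruct (classic (inhabited (E -> V))) as [[f]|N].
      + exists [f]; intros g; exists f; split; [left; reflexivity|intros e []].
      + exists []; intros g; destruct (N (inhabits g)).
    - exists (flat_map (fun f => map (fun v e' => if decide (e' = e) then v else f e') lv) fs).
      intros g; destruct (hfs g) as (f & hf & fg).
      exists (fun e' => if decide (e' = e) then g e else f e'); split.
      + apply in_flat_map; exists f; split; [exact hf|].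
        apply (in_map (fun v e' => if decide (e' = e) then v else f e')), hv.
      + intros e' he'; destruct (decide (e' = e)) eqn:D.
        * apply (proj1 (decide_true _)) in D; congruence.
        * destruct he' as [<-|he']; [|auto].
          rewrite (proj2 (decide_true _) eq_refl) in D; discriminate. }
  destruct (H le) as [fs hfs]; exists fs; intros g.
  destruct (hfs g) as (f & hf & fg); replace g with f; [exact hf|].
  apply functional_extensionality; intros e; apply fg, he.
Qed.

Lemma almost_disjoint_pair {I X : Type} (A : I -> list X) :
  (forall i j x y, x <> y -> In x (A i) -> In y (A i) -> In x (A j) -> In y (A j) -> i = j) ->
  almost_disjoint 1 A.
Proof.
  intros H i j [|x [|y l]] nd hi hj lt; simpl in lt; try lia.
  inversion nd as [|? ? h _]; subst.
  apply (H i j x y); [| apply hi | apply hi | apply hj | apply hj]; simpl; auto.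
  intros <-; apply h; left; reflexivity.
Qed.

Lemma almost_disjoint_one {I X : Type} (A : I -> list X) (i j : I) (x y : X) :
  almost_disjoint 1 A -> x <> y ->
  In x (A i) -> In y (A i) -> In x (A j) -> In y (A j) -> i = j.
Proof.
  intros ad ne xi yi xj yj; apply (ad i j [x; y]).
  - constructor; [intros [h|[]]; congruence|constructor; [intros []|constructor]].
  - intros z [<-|[<-|[]]]; assumption.
  - intros z [<-|[<-|[]]]; assumption.
  - simpl; lia.
Qed.

Lemma NoDup_map_inj {X Y : Type} (f : X -> Y) (l : list X) (x y : X) :
  NoDup (map f l) -> In x l -> In y l -> f x = f y -> x = y.
Proof.
  induction l as [|z l IH]; intros nd hx hy E; [destruct hx|].
  simpl in nd; inversion nd as [|? ? h1 h2]; subst.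
  destruct hx as [->|hx], hy as [->|hy]; auto; exfalso; apply h1.
  - rewrite E; apply in_map, hy.
  - rewrite <- E; apply in_map, hx.
Qed.

(* For the step, the roots are indexed by the old edges; there is one copy of the
   old system for each section [r] over the roots, and the edge [e] in that
   copy is extended by the point [(e, r e)]. *)
Lemma section_system (t : nat) (V : Type) : Finite V ->
  exists (I E : Type) (B : E -> list (I * V)),
  Finite I /\ Finite E /\ (forall e, NoDup (map fst (B e)) /\ length (B e) = t) /\
  almost_disjoint 1 B /\
  forall v : I -> V, exists e, forall p, In p (B e) -> snd p = v (fst p).
Proof.
  intros finV; induction t as [|t (I & E & B & finI & finE & hB & ad & H)].
  - exists Empty_set, unit, (fun _ => []).
    split; [exists []; intros []|split; [exists [tt]; intros []; left; reflexivity|]].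
    split; [split; [constructor|reflexivity]|split].
    + intros [] []; reflexivity.
    + intros v; exists tt; intros p [].
  - set (up := fun (r : E -> V) (p : I * V) => (inr (r, fst p), snd p) : (E + (E -> V) * I) * V).
    assert (up_in : forall r r' p l, In (up r p) (map (up r') l) -> r = r' /\ In p l).
    { intros r r' p l h; apply in_map_iff in h; destruct h as (q & Eq & h).
      unfold up in Eq; injection Eq; intros E1 E2 E3; split; [congruence|].
      replace p with q; [exact h|]; destruct p, q; simpl in *; congruence. }
    exists (E + (E -> V) * I)%type, ((E -> V) * E)%type,
      (fun q => (inl (snd q), fst q (snd q)) :: map (up (fst q)) (B (snd q))).
    split; [|split; [|split; [|split]]].
    + apply Finite_sum; [exact finE|]; apply Finite_prod; [|exact finI].
      apply Finite_functions; assumption.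
    + apply Finite_prod; [|exact finE]; apply Finite_functions; assumption.
    + intros [r e]; simpl; rewrite length_map, map_map; destruct (hB e) as [h1 h2].
      split; [|congruence]; constructor.
      * intros h; apply in_map_iff in h; destruct h as (q & Eq & _); discriminate.
      * replace (map (fun p => fst (up r p)) (B e)) with
          (map (fun i => inr (r, i) : E + (E -> V) * I) (map fst (B e)))
          by (rewrite map_map; reflexivity).
        apply Injective_map_NoDup; [|exact h1]; intros x y Exy; congruence.
    (* Edges of different copies share at most the point over one new root, and distinct edges of
       one copy have different new roots. *)
    + apply almost_disjoint_pair.
      assert (common : forall (q q' : (E -> V) * E) x,
        In x ((inl (snd q), fst q (snd q)) :: map (up (fst q)) (B (snd q))) ->
        In x ((inl (snd q'), fst q' (snd q')) :: map (up (fst q')) (B (snd q'))) ->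
        (snd q = snd q' /\ x = (inl (snd q), fst q (snd q))) \/
        (fst q = fst q' /\ exists p, x = up (fst q) p /\ In p (B (snd q)) /\ In p (B (snd q')))).
      { intros q q' x [<-|hx] hx'.
        - destruct hx' as [Eq|hx']; [left; split; [congruence|reflexivity]|].
          apply in_map_iff in hx'; destruct hx' as (p & Eq & _); discriminate.
        - right; apply in_map_iff in hx; destruct hx as (p & <- & hp).
          destruct hx' as [Eq|hx']; [discriminate|].
          apply up_in in hx'; destruct hx'; eauto. }
      intros q q' x y ne xq yq xq' yq'.
      destruct (common q q' x xq xq') as [[E1 E2]|[E1 (p & E2 & h1 & h2)]],
        (common q q' y yq yq') as [[E3 E4]|[E3 (p' & E4 & h3 & h4)]].
      * congruence.
      * destruct q, q'; simpl in *; congruence.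
      * destruct q, q'; simpl in *; congruence.
      * assert (snd q = snd q').
        { apply (almost_disjoint_one B _ _ p p' ad); auto; congruence. }
        destruct q, q'; simpl in *; congruence.
    (* The copy is chosen so that [r] agrees with [v] on the new roots; whichever old edge is found
       there, its added point then lies on [v]. *)
    + intros v; set (r := fun e => v (inl e)).
      destruct (H (fun i => v (inr (r, i)))) as [e he].
      exists (r, e); intros p [<-|hp]; [reflexivity|].
      apply in_map_iff in hp; destruct hp as (q & <- & hq); exact (he q hq).
Qed.

(* If no copy [{a} * V] of the system for [n] colours contains a monochromatic
   set in the first [n] colours, then each copy contains a point of the last
   colour, and these points form a section. *)
Lemma monochromatic_system (t n : nat) :
  exists (V E : Type) (B : E -> list V),
  Finite V /\ Finite E /\ (forall e, NoDup (B e) /\ length (B e) = t) /\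
  almost_disjoint 1 B /\
  forall f : V -> nat, (forall v, f v < n) ->
    exists e, forall x y, In x (B e) -> In y (B e) -> f x = f y.
Proof.
  induction n as [|n (V & E & B & finV & finE & hB & ad & H)].
  (* One point and no edges: the point is what makes the condition on [f] fail for zero colours. *)
  - exists unit, Empty_set, (fun e : Empty_set => match e with end).
    split; [exists [tt]; intros []; left; reflexivity|split; [exists []; intros []|]].
    split; [intros []|split; [intros []|]].
    intros f h; specialize (h tt); lia.
  - destruct (section_system t V finV) as (I & D & A & finI & finD & hA & adA & HA).
    assert (copy : forall (a : I) (e : E) p, In p (map (pair a) (B e)) <->
      fst p = a /\ In (snd p) (B e)).
    { intros a e [a' x]; rewrite in_map_iff; simpl; split.
      - intros (y & E1 & h); injection E1; intros <- <-; auto.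
      - intros [-> h]; eauto. }
    exists (I * V)%type, (I * E + D)%type, (fun e => match e with
      | inl (a, e) => map (pair a) (B e) | inr d => A d end).
    split; [apply Finite_prod; assumption|split; [|split; [|split]]].
    + apply Finite_sum; [apply Finite_prod|]; assumption.
    + intros [[a e]|d].
      * rewrite length_map; split; [|apply hB].
        apply Injective_map_NoDup; [intros x y E1; congruence|apply hB].
      * destruct (hA d) as [h1 h2]; split; [|exact h2].
        exact (NoDup_map_inv _ _ h1).
    + apply almost_disjoint_pair.
      intros [[a e]|d] [[a' e']|d'] x y ne hx hy hx' hy'.
      * apply copy in hx, hy, hx', hy'.
        assert (e = e'); [|destruct hx, hx'; congruence].
        apply (almost_disjoint_one B e e' (snd x) (snd y) ad); try tauto.
        intros Exy; apply ne; destruct x, y; simpl in *; destruct hx, hy; congruence.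
      (* A set of the section system has distinct first coordinates, so it meets each copy in at
         most one point. *)
      * exfalso; apply ne; apply (NoDup_map_inj fst (A d')); auto; [apply hA|].
        apply copy in hx, hy; destruct hx, hy; congruence.
      * exfalso; apply ne; apply (NoDup_map_inj fst (A d)); auto; [apply hA|].
        apply copy in hx', hy'; destruct hx', hy'; congruence.
      * f_equal; exact (almost_disjoint_one A d d' x y adA ne hx hy hx' hy').
    + intros f hf.
      destruct (classic (exists a, forall x, f (a, x) <> n)) as [[a ha]|N].
      * destruct (H (fun x => f (a, x))) as [e he].
        { intros x; specialize (hf (a, x)); specialize (ha x); lia. }
        exists (inl (a, e)); intros x y hx hy; apply copy in hx, hy.
        destruct x as [a1 x], y as [a2 y]; simpl in *.
        destruct hx as [-> hx], hy as [-> hy]; auto.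
      * destruct (functional_choice (fun a x => f (a, x) = n)) as [v hv].
        { intros a; apply NNPP; intros Na; apply N; exists a; intros x Ex.
          apply Na; eauto. }
        destruct (HA v) as [d hd]; exists (inr d).
        assert (all : forall p, In p (A d) -> f p = n).
        { intros [a x] hp; pose proof (hd _ hp) as E1; simpl in E1; subst x; apply hv. }
        intros x y hx hy; rewrite !all by assumption; reflexivity.
Qed.

Lemma eq_card_of_list {X : Type} (S : X -> Prop) (l : list X) :
  NoDup l -> (forall x, In x l <-> S x) -> eq_card {x | S x} (fin (length l)).
Proof.
  intros nd h; replace S with (fun x => In x l); [exact (card_list l nd)|].
  apply functional_extensionality; intros x.
  apply propositional_extensionality, h.
Qed.

Lemma system_of_lists (L X I : Type) (t k : nat) (B : I -> list X) :
  eq_card I L -> k < t -> (forall x, exists i, In x (B i)) ->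
  (forall i, NoDup (B i) /\ length (B i) = t) -> almost_disjoint k B ->
  system L t (k + 1) X I (fun i x => In x (B i)).
Proof.
  intros IL kt cover hB ad; repeat split.
  - exact IL.
  - intros i j E; apply (ad i j (B i)); [apply hB|apply incl_refl| |].
    + intros x hx; rewrite <- (equal_f E x); exact hx.
    + destruct (hB i); lia.
  - exact cover.
  - intros i; destruct (hB i) as [nd <-]; apply card_list, nd.
  - set (l := select (fun x => In x (B j)) (B i)).
    assert (nd : NoDup l) by (apply NoDup_filter, hB).
    apply le_card_trans with (fin (length l)).
    + apply eq_card_le, eq_card_of_list; [exact nd|intros x; exact (in_select _ _ x)].
    + apply fin_le_card, Nat.nlt_ge; intros lt; apply H, (ad i j l); try lia; auto.
      * intros x hx; apply in_select in hx; tauto.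
      * intros x hx; apply in_select in hx; tauto.
  - intros le; set (l := select (fun x => In x (B j)) (B i)).
    assert (nd : NoDup l) by (apply NoDup_filter, hB).
    assert (le' : k + 1 <= length l).
    { apply le_card_fin, (le_card_trans _ _ _ le), eq_card_le.
      apply eq_card_of_list; [exact nd|intros x; exact (in_select _ _ x)]. }
    apply H, (ad i j l); try lia; auto.
    + intros x hx; apply in_select in hx; tauto.
    + intros x hx; apply in_select in hx; tauto.
Qed.

(* The family is enlarged to size [L] by pairwise disjoint sets. *)
Lemma exists_system_not_cf_colorable (L N X J : Type) (t k : nat) (B : J -> list X) :
  infinite_card L -> le_card J L -> k < t ->
  (forall j, NoDup (B j) /\ length (B j) = t) -> almost_disjoint k B ->
  (forall f : X -> N, exists j, forall x, In x (B j) ->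
    exists y, In y (B j) /\ y <> x /\ f y = f x) ->
  exists (X' I : Type) (A : I -> X' -> Prop),
    system L t (k + 1) X' I A /\ ~ cf_colorable X' I N A.
Proof.
  intros infL leJ kt hB ad H.
  set (D := fun i : J + L => match i with
    | inl j => map inl (B j)
    | inr a => map (fun m => inr (a, m)) (seq 0 t) end : list (X + L * nat)).
  (* A system has no points outside its sets, so the ambient type is cut down to the covered
     points. *)
  set (X' := {y | exists i, In y (D i)}).
  destruct (functional_choice (fun i (l : list X') => map (@proj1_sig _ _) l = D i))
    as [DX hDX].
  { intros i; apply lift_list; intros y hy; exists i; exact hy. }
  assert (inDX : forall i (x : X'), In x (DX i) <-> In (proj1_sig x) (D i)).
  { intros i x; rewrite <- hDX, in_map_iff; split; [eauto|].
    intros (x' & E & h); replace x with x'; [exact h|apply subtype_eq, E]. }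
  assert (hD : forall i, NoDup (D i) /\ length (D i) = t).
  { intros [j|a]; simpl; rewrite length_map; [|rewrite length_seq]; split.
    - apply Injective_map_NoDup; [intros x y E; congruence|apply hB].
    - apply hB.
    - apply Injective_map_NoDup; [intros x y E; congruence|apply seq_NoDup].
    - reflexivity. }
  assert (adD : forall i i' l, NoDup l -> incl l (D i) -> incl l (D i') ->
    k < length l -> i = i').
  { intros i i' l nd hi hi' lt; destruct l as [|y l]; [simpl in lt; lia|].
    pose proof (hi y (or_introl eq_refl)) as h.
    pose proof (hi' y (or_introl eq_refl)) as h'.
    destruct i as [j|a], i' as [j'|a']; simpl in h, h', hi, hi';
      apply in_map_iff in h, h'; destruct h as (u & <- & _), h' as (u' & E & _);
      try discriminate; [|congruence].
    assert (lift : exists l', map inl l' = @inl X (L * nat) u :: l).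
    { destruct (lift_list (fun y : X + L * nat => exists x, inl x = y) (inl u :: l))
        as [m hm].
      { intros y hy; apply hi, in_map_iff in hy; destruct hy as (x & <- & _); eauto. }
      destruct (functional_choice (fun (z : {y : X + L * nat | exists x, inl x = y}) x =>
        inl x = proj1_sig z)) as [p hp]; [intros z; exact (proj2_sig z)|].
      exists (map p m); rewrite map_map, <- hm; apply map_ext, hp. }
    destruct lift as [l' hl']; f_equal; rewrite <- hl' in *.
    assert (back : forall j, incl (map inl l') (map (@inl X (L * nat)) (B j)) ->
      incl l' (B j)).
    { intros i hinc x hx; apply (in_map (@inl X (L * nat))), hinc, in_map_iff in hx.
      destruct hx as (x' & E' & hx'); congruence. }
    apply (ad j j' l'); [exact (NoDup_map_inv _ _ nd)|auto|auto|].
    rewrite length_map in lt; exact lt. }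
  exists X', (J + L)%type, (fun i x => In x (DX i)); split.
  - apply system_of_lists; [| exact kt | | |].
    + apply Cantor_Bernstein; [apply le_card_add; auto using le_card_refl|].
      exists inr; intros x y E; congruence.
    + intros [y [i hy]]; exists i; apply inDX; exact hy.
    + intros i; destruct (hD i) as [h1 h2]; rewrite <- hDX in h1, h2.
      rewrite length_map in h2; split; [exact (NoDup_map_inv _ _ h1)|exact h2].
    + intros i i' l nd hi hi' lt; apply (adD i i' (map (@proj1_sig _ _) l)).
      * apply Injective_map_NoDup; [|exact nd]; intros x y; apply subtype_eq.
      * rewrite <- hDX; apply incl_map, hi.
      * rewrite <- hDX; apply incl_map, hi'.
      * rewrite length_map; exact lt.
  - intros [f hf]; rewrite cf_coloring_iff in hf.
    destruct (infinite_inhabited L infL) as [a].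
    destruct (hf (inr a)) as (x0 & _).
    (* The colouring is carried back to [X]; uncovered points get the colour of [x0], a point of a
       padding set. *)
    destruct (functional_choice (fun x c => forall h : exists i, In (inl x) (D i),
      f (exist _ (inl x) h) = c)) as [f' hf'].
    { intros x; destruct (classic (exists i, In (inl x) (D i))) as [h|h].
      - exists (f (exist _ (inl x) h)); intros h'; f_equal; apply subtype_eq; reflexivity.
      - exists (f x0); tauto. }
    destruct (H f') as [j hj]; destruct (hf (inl j)) as ([y hy] & h1 & h2).
    apply inDX in h1; simpl in h1; apply in_map_iff in h1; destruct h1 as (x & <- & hx).
    destruct (hj x hx) as (z & hz & ne & E).
    assert (hz' : exists i, In (inl z) (D i)) by (exists (inl j); apply in_map, hz).
    apply ne; assert (E' : exist (fun y => exists i, In y (D i)) (inl z) hz' = exist _ (inl x) hy).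
    { apply h2; [apply inDX; simpl; apply in_map, hz|]; rewrite !hf'; exact E. }
    apply (f_equal (@proj1_sig _ _)) in E'; simpl in E'; congruence.
Qed.

(** * Iterated successors and the matching of the bounds *)

Lemma succ_n_split (a b : nat) (K L : Type) :
  succ_n (a + b) K L -> exists C, succ_n a K C /\ succ_n b C L.
Proof.
  revert L; induction b as [|b IH]; intros L.
  - rewrite Nat.add_0_r; intros h; exists L; split; [exact h|].
    exists (fun x => x), (fun x => x); auto.
  - rewrite Nat.add_succ_r; intros (D & hD & suc).
    destruct (IH D hD) as (C & h1 & h2); exists C; split; [exact h1|].
    exists D; auto.
Qed.

Lemma succ_n_unique (n : nat) (K L L' : Type) :
  succ_n n K L -> succ_n n K L' -> le_card L L'.
Proof.
  revert L L'; induction n as [|n IH]; intros L L'.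
  - intros h h'; apply le_card_trans with K; apply eq_card_le; [apply eq_card_sym|]; assumption.
  - intros (C & hC & [_ least]) (C' & hC' & [[le nle] _]); apply least.
    pose proof (IH C C' hC hC') as leC; split.
    + apply le_card_trans with C'; assumption.
    + intros h; apply nle, le_card_trans with C; assumption.
Qed.

(** Under GCH this is a concrete [n]-th successor, whereas [succ_n] is only a relation; it provides
    the successors of an arbitrary infinite palette [N]. *)
Fixpoint iterated_powerset (n : nat) (A : Type) : Type :=
  match n with 0 => A | S m => iterated_powerset m A -> Prop end.

Lemma GCH_succ_n_powerset (n : nat) (A : Type) :
  GCH -> infinite_card A -> succ_n n A (iterated_powerset n A).
Proof.
  intros gch inf; induction n as [|n IH]; simpl.
  - exists (fun x => x), (fun x => x); auto.
  - exists (iterated_powerset n A); split; [exact IH|].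
    apply GCH_is_succ_powerset; [exact gch|exact (succ_n_infinite n A _ inf IH)].
Qed.

(** A limit cardinal leaves some [B] strictly between a smaller cardinal and [K], and under GCH the
    powerset is at most [B]. *)
Lemma limit_card_powerset (n : nat) (A K : Type) :
  GCH -> limit_card K -> infinite_card A -> lt_card A K ->
  lt_card (iterated_powerset n A) K.
Proof.
  intros gch [_ lim] inf lt; induction n as [|n IH]; [exact lt|]; simpl.
  destruct (lim _ IH) as (B & AB & [leB nleB]).
  assert (le : le_card (iterated_powerset n A -> Prop) B).
  { apply GCH_is_succ_powerset; [exact gch| |exact AB].
    exact (succ_n_infinite n A _ inf (GCH_succ_n_powerset n A gch inf)). }
  split; [apply le_card_trans with B; assumption|].
  intros h; apply nleB, le_card_trans with (1 := h), le.
Qed.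

Lemma Finite_le_card_fin (A : Type) : Finite A -> exists n, le_card A (fin n).
Proof.
  intros [l hl]; exists (length l).
  apply le_card_of_rel with (fun x (m : fin (length l)) =>
    nth_error l (proj1_sig m) = Some x).
  - intros x; destruct (In_nth_error _ _ (hl x)) as [m hm].
    assert (h : m < length l) by (apply nth_error_Some; congruence).
    exists (exist _ m h); exact hm.
  - intros; congruence.
Qed.

Lemma finite_colors_lower_bound (L N : Type) (k t : nat) :
  infinite_card L -> Finite N -> 1 <= k < t ->
  exists (X I : Type) (A : I -> X -> Prop),
    system L t (k + 1) X I A /\ ~ cf_colorable X I N A.
Proof.
  intros infL finN kt; destruct (Finite_le_card_fin N finN) as (n & g & hg).
  destruct (monochromatic_system t n) as (V & E & B & _ & finE & hB & ad & H).
  apply exists_system_not_cf_colorable with V E B; [exact infL| |lia|exact hB| |].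
  - destruct (Finite_le_card_fin E finE) as [m hm].
    apply le_card_trans with (1 := hm), le_card_trans with nat; [|exact infL].
    exists (@proj1_sig _ _); apply subtype_eq.
  (* The hypergraph is linear, which covers every [k >= 1]. *)
  - intros i j l nd hi hj lt; apply (ad i j l); auto; lia.
  - intros f; destruct (H (fun v => proj1_sig (g (f v)))) as [e he].
    { intros v; apply (proj2_sig (g (f v))). }
    exists e; intros x hx; destruct (hB e) as [nd len].
    assert (Hy : exists y, In y (B e) /\ y <> x).
    { apply NNPP; intros M.
      assert (sub : incl (B e) [x]).
      { intros y hy; left; apply NNPP; intros ne; apply M; eauto. }
      pose proof (NoDup_incl_length nd sub) as le; simpl in le; lia. }
    destruct Hy as (y & hy & ne); exists y; split; [exact hy|split; [exact ne|]].
    apply hg, subtype_eq, he; assumption.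
Qed.

(** The defeating family has size at most [C], the [i]-th successor of the palette, and starts from
    sets of [t - i * k] points; padding brings it to size [L], which may exceed [C]. *)
Lemma infinite_colors_lower_bound (P C L : Type) (k i t : nat) :
  GCH -> infinite_card P -> succ_n i P C -> le_card C L ->
  1 <= i -> i * k < t <= (i + 1) * k -> k < t ->
  exists (X I : Type) (A : I -> X -> Prop),
    system L t (k + 1) X I A /\ ~ cf_colorable X I P A.
Proof.
  intros gch inf suc le hi ht kt; destruct i as [|i]; [lia|].
  destruct (labelled_system_succ_n P C k (t - S i * k) i gch inf) as
    (X & J & B & b & F & _ & leJ & hB & ad & H); [lia|exact suc|].
  replace (S i * k + (t - S i * k)) with t in hB by lia.
  apply exists_system_not_cf_colorable with X J B.
  - apply le_card_trans with C; [|exact le]; exact (succ_n_infinite _ P C inf suc).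
  - apply le_card_trans with C; assumption.
  - exact kt.
  - intros j; destruct (hB j); tauto.
  - exact ad.
  - intros f; destruct (H f) as (j & _ & hj); exists j; intros x hx.
    destruct (hj x hx) as [[[] _]|h]; exact h.
Qed.

Theorem theorem3p9 :
  GCH ->
  forall (K : Type), (limit_card K \/ eq_card K nat) ->
  forall k : nat, 1 <= k ->
  forall n t : nat, k < t ->
  (forall i : nat, 1 <= i <= n -> i * k < t <= (i + 1) * k ->
     forall L M : Type, succ_n n K L -> succ_n (n + 1 - i) K M ->
     chiCF_eq L t (k + 1) M) /\
  ((n + 1) * k < t ->
     forall L : Type, succ_n n K L -> chiCF_eq L t (k + 1) K).
Proof.
  intros gch K hK k k1 n t kt.
  assert (inf : infinite_card K).
  { destruct hK as [[h _]|h]; [exact h|apply eq_card_le, eq_card_sym, h]. }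
  split.
  - intros i hi ht L M sucL sucM; split.
    + intros X I A sys.
      (* [M] is [n + 1 - i] successors above [K], so [L] is [i - 1] above [M], and the upper bound
         asks exactly for [i * k < t]. *)
      replace n with ((n + 1 - i) + (i - 1)) in sucL by lia.
      destruct (succ_n_split _ _ _ _ sucL) as (M' & h1 & h2).
      refine (cf_colorable_le A (succ_n_unique _ _ _ _ h1 sucM) _).
      assert (lt : (i - 1 + 1) * k < t) by (replace (i - 1 + 1) with i by lia; lia).
      exact (cf_colorable_succ_n M' L k (i - 1) t (succ_n_infinite _ K M' inf h1) h2 lt
        X I A sys).
    + intros N [_ nle].
      (* A palette below [M] is at most the [(n - i)]-th successor of [K], and [L] is the [i]-th
         successor of that. *)
      replace (n + 1 - i) with (S (n - i)) in sucM by lia.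
      destruct sucM as (C & hC & [_ least]).
      assert (leN : le_card N C).
      { apply NNPP; intros h; apply nle, least.
        split; [apply not_le_card|]; exact h. }
      replace n with ((n - i) + i) in sucL by lia.
      destruct (succ_n_split _ _ _ _ sucL) as (P & h1 & h2).
      destruct (infinite_colors_lower_bound P L L k i t) as (X & I & A & sys & ncol);
        auto using le_card_refl; try lia.
      { exact (succ_n_infinite _ K P inf h1). }
      exists X, I, A; split; [exact sys|]; intros col; apply ncol.
      refine (cf_colorable_le A _ col).
      apply le_card_trans with C; [exact leN|exact (succ_n_unique _ _ _ _ hC h1)].
  - intros ht L sucL; split.
    + intros X I A; exact (cf_colorable_succ_n K L k n t inf sucL ht X I A).
    + intros N lt.
      assert (infL : infinite_card L) by exact (succ_n_infinite n K L inf sucL).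
      destruct (classic (Finite N)) as [fin|nfin].
      { apply finite_colors_lower_bound; auto. }
      apply not_Finite_infinite in nfin.
      destruct hK as [lim|Knat].
      2: { destruct lt as [_ nle]; exfalso; apply nle, le_card_trans with nat.
           - apply eq_card_le, Knat.
           - exact nfin. }
      (* Rounding down with [t - 1] gives the [i] with [i * k < t <= (i + 1) * k]. The [i]-th
         successor of [N] is still below the limit [K], hence at most [L]. *)
      assert (d : t - 1 = k * ((t - 1) / k) + (t - 1) mod k) by (apply Nat.div_mod_eq).
      assert (m : (t - 1) mod k < k) by (apply Nat.mod_upper_bound; lia).
      set (i := (t - 1) / k) in *.
      apply infinite_colors_lower_bound with (iterated_powerset i N) i; auto; try nia.
      * apply GCH_succ_n_powerset; assumption.
      * apply le_card_trans with K; [|exact (succ_n_le_card n K L sucL)].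
        apply limit_card_powerset; assumption.
Qed.
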